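(* Let $M^{2n+1}(\varphi,\xi,\eta,g)$ be a Kenmotsu manifold of dimension $2n+1$ that admits a gradient almost $\eta$-Ricci soliton, i.e. there are smooth functions $f,\lambda,\mu:M\to\mathbb{R}$ such that $$\mathrm{Hess}\,f+\mathrm{Ric}+\lambda\,g+\mu\,\eta\otimes\eta=0 .$$ Suppose that $\xi$ leaves the scalar curvature $r$ of $g$ invariant, i.e. $\xi(r)=0$. Then $(M,g)$ is an Einstein manifold with constant scalar curvature $r=-2n(2n+1)$.
   Context: An almost contact structure on a smooth manifold $M^{2n+1}$ of dimension $2n+1$ is a triple $(\varphi,\xi,\eta)$, where $\varphi$ is a $(1,1)$-tensor, $\xi$ a vector field (the Reeb vector field) and $\eta$ a $1$-form with $\varphi^2=-I+\eta\otimes\xi$ and $\eta(\xi)=1$. A Riemannian metric $g$ is compatible if $g(\varphi X,\varphi Y)=g(X,Y)-\eta(X)\eta(Y)$ for all vector fields $X,Y$; then $M(\varphi,\xi,\eta,g)$ is an almost contact metric manifold. It is a Kenmotsu manifold if $(\nabla_X\varphi)Y=g(\varphi X,Y)\,\xi-\eta(Y)\,\varphi X$ for all vector fields $X,Y$, where $\nabla$ is the Levi-Civita connection of $g$. Here $\mathrm{Hess}\,f$ is the Hessian of $f$ with respect to $g$, $\mathrm{Ric}$ the Ricci tensor of $g$, and $(\eta\otimes\eta)(X,Y)=\eta(X)\eta(Y)$. Einstein means that $\mathrm{Ric}$ is a constant multiple of $g$. *)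

(* Defs.v *)
From HB Require Import structures.
From mathcomp Require Import all_boot all_order all_algebra.
From mathcomp Require Import all_classical all_reals all_analysis.

Set Implicit Arguments.
Unset Strict Implicit.
Unset Printing Implicit Defensive.

Import Order.TTheory GRing.Theory Num.Theory.
Import numFieldNormedType.Exports.
Local Open Scope classical_set_scope.
Local Open Scope ring_scope.

(* Topological manifolds of dimension m: a chart a is a homeomorphism
   chart_map a, with inverse chart_inv a, from an open set dom a of M onto an
   open set of R^m. Both maps are total functions; only their values on dom a and on
   chart_map a @` dom a matter. *)
Record chartedSpace (R : realType) (m : nat) := ChartedSpace {
  points :> topologicalType;
  points_hausdorff : hausdorff_space points;
  points_second_countable : @second_countable points;
  chart : Type;
  dom : chart -> set points;
  chart_map : chart -> points -> 'rV[R]_m;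
  chart_inv : chart -> 'rV[R]_m -> points;
  dom_open : forall a, open (dom a);
  image_open : forall a, open (chart_map a @` dom a);
  chart_mapK : forall a p, dom a p -> chart_inv a (chart_map a p) = p;
  chart_map_continuous : forall a p,
    dom a p -> {for p, continuous (chart_map a)};
  chart_inv_continuous : forall a x,
    (chart_map a @` dom a) x -> {for x, continuous (chart_inv a)};
  dom_cover : forall p, exists a, dom a p
}.
Arguments dom {R m c}.
Arguments chart_map {R m c}.
Arguments chart_inv {R m c}.

Section Calculus.
Context {R : realType} {m : nat} {M : chartedSpace R m}.
Implicit Types (a b : chart M) (p q : M) (W : set M) (f : M -> R).

(* The coordinate derivative df/dx^i in the chart a (meaningful on dom a). *)
Definition pd a (i : 'I_m) f : M -> R :=
  fun p => 'D_(delta_mx 0 i) (f \o chart_inv a) (chart_map a p).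

Definition iter_pd a (s : seq 'I_m) f : M -> R := foldr (pd a) f s.

(* C^oo on W `&` dom a, read in the chart a: all iterated coordinate
   derivatives exist and are continuous. *)
Definition chart_smooth a W f : Prop :=
  forall (s : seq 'I_m) p, W p -> dom a p ->
    {for p, continuous (iter_pd a s f)} /\
    forall i,
      derivable (iter_pd a s f \o chart_inv a) (chart_map a p) (delta_mx 0 i).

(* dy^j/dx^i, with x the coordinates of a and y those of b. *)
Definition jac a b p : 'M[R]_m :=
  \matrix_(i, j) pd a i (fun q => chart_map b q 0 j) p.

End Calculus.

Record manifold (R : realType) (m : nat) := Manifold {
  atlas :> chartedSpace R m;
  smooth_transition : forall (a b : chart atlas) (j : 'I_m),
    chart_smooth a (dom b) (fun q => chart_map b q 0 j)
}.

(* A tensor field on M is given by its components in each chart. A tangent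
   vector with components u is a row; the 1-form eta is the column with
   eta(u) = u *m eta; the (1,1)-tensor phi is the matrix with
   phi(u) = u *m phi; the (0,2)-tensor g is the matrix with
   g(u, v) = u *m g *m v^T. Components in different charts are related by the
   usual transformation laws. *)
Section TensorFields.
Context {R : realType} {m : nat} {M : manifold R m}.
Implicit Types (a b : chart M) (p : M).

Definition smooth (f : M -> R) : Prop := forall a, chart_smooth a (dom a) f.

Definition smooth_comp k l (T : chart M -> M -> 'M[R]_(k, l)) : Prop :=
  forall a i j, chart_smooth a (dom a) (fun p => T a p i j).

Definition vector_field (X : chart M -> M -> 'rV[R]_m) : Prop :=
  smooth_comp X /\
  forall a b p, dom a p -> dom b p -> X b p = X a p *m jac a b p.

Definition one_form (w : chart M -> M -> 'cV[R]_m) : Prop :=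
  smooth_comp w /\
  forall a b p, dom a p -> dom b p -> w a p = jac a b p *m w b p.

Definition tensor11 (T : chart M -> M -> 'M[R]_m) : Prop :=
  smooth_comp T /\
  forall a b p, dom a p -> dom b p ->
    T a p *m jac a b p = jac a b p *m T b p.

Definition tensor02 (T : chart M -> M -> 'M[R]_m) : Prop :=
  smooth_comp T /\
  forall a b p, dom a p -> dom b p ->
    T a p = jac a b p *m T b p *m (jac a b p)^T.

Definition ev1 (w : 'cV[R]_m) (u : 'rV[R]_m) : R := (u *m w) 0 0.

Definition ev2 (B : 'M[R]_m) (u v : 'rV[R]_m) : R := (u *m B *m v^T) 0 0.

Definition riemannian_metric (g : chart M -> M -> 'M[R]_m) : Prop :=
  tensor02 g /\
  forall a p, dom a p ->
    (forall u v, ev2 (g a p) u v = ev2 (g a p) v u) /\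
    (forall u, u != 0 -> 0 < ev2 (g a p) u u).

(* phi^2 = - I + eta (x) xi  and  eta(xi) = 1. *)
Definition almost_contact (phi : chart M -> M -> 'M[R]_m)
    (xi : chart M -> M -> 'rV[R]_m) (eta : chart M -> M -> 'cV[R]_m) : Prop :=
  [/\ tensor11 phi, vector_field xi, one_form eta &
    forall a p, dom a p ->
      (forall u : 'rV[R]_m,
         u *m phi a p *m phi a p = - u + ev1 (eta a p) u *: xi a p) /\
      ev1 (eta a p) (xi a p) = 1].

Definition compatible_metric (phi g : chart M -> M -> 'M[R]_m)
    (eta : chart M -> M -> 'cV[R]_m) : Prop :=
  forall a p, dom a p -> forall u v : 'rV[R]_m,
    ev2 (g a p) (u *m phi a p) (v *m phi a p) =
    ev2 (g a p) u v - ev1 (eta a p) u * ev1 (eta a p) v.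

Definition almost_contact_metric phi xi eta g : Prop :=
  [/\ almost_contact phi xi eta, riemannian_metric g
    & compatible_metric phi g eta].

End TensorFields.

(* Vector fields X, Y on (an open subset of) the domain of one chart a are maps
   M -> 'rV[R]_m giving their components in that chart. *)
Section LocalFields.
Context {R : realType} {m : nat} {M : manifold R m}.
Implicit Types (a b : chart M) (p : M) (X Y Z : M -> 'rV[R]_m).

Definition local_field a (W : set M) X : Prop :=
  forall k, chart_smooth a W (fun p => X p 0 k).

(* The function X(f). *)
Definition along a X (f : M -> R) : M -> R :=
  fun p => \sum_i X p 0 i * pd a i f p.

Definition bracket a X Y : M -> 'rV[R]_m := fun p =>
  \row_k (along a X (fun q => Y q 0 k) p - along a Y (fun q => X q 0 k) p).

Definition frame (i : 'I_m) : M -> 'rV[R]_m := fun=> delta_mx 0 i.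

Definition nabla_of (G : chart M -> M -> 'I_m -> 'I_m -> 'rV[R]_m)
    a X Y : M -> 'rV[R]_m := fun p =>
  \row_k along a X (fun q => Y q 0 k) p
  + \sum_i \sum_j (X p 0 i * Y p 0 j) *: G a p i j.

End LocalFields.

(* An affine connection: symbol a p i j is the vector nabla_{d_i} d_j in the
   coordinate frame of a. The last axiom says that the vector field nabla_X Y
   does not depend on the chart. *)
Record affine_connection (R : realType) (m : nat) (M : manifold R m) :=
  AffineConnection {
    symbol : chart M -> M -> 'I_m -> 'I_m -> 'rV[R]_m;
    symbol_smooth : forall a i j,
      local_field a (dom a) (fun p => symbol a p i j);
    symbol_covariant : forall (a b : chart M) (X Y : M -> 'rV[R]_m),
      local_field a (dom b) X -> local_field a (dom b) Y ->
      forall p, dom a p -> dom b p ->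
        nabla_of symbol b (fun q => X q *m jac a b q)
                          (fun q => Y q *m jac a b q) p
        = nabla_of symbol a X Y p *m jac a b p
  }.

Section Riemannian.
Context {R : realType} {m : nat} {M : manifold R m}.
Implicit Types (a : chart M) (p : M) (X Y Z : M -> 'rV[R]_m).
Implicit Types (D : affine_connection M) (g phi : chart M -> M -> 'M[R]_m).

Definition nabla D a X Y : M -> 'rV[R]_m := nabla_of (symbol D) a X Y.

Definition torsion_free D : Prop :=
  forall a X Y, local_field a (dom a) X -> local_field a (dom a) Y ->
  forall p, dom a p -> nabla D a X Y p - nabla D a Y X p = bracket a X Y p.

Definition metric_connection g D : Prop :=
  forall a X Y Z, local_field a (dom a) X -> local_field a (dom a) Y ->
    local_field a (dom a) Z ->
  forall p, dom a p ->
    along a X (fun q => ev2 (g a q) (Y q) (Z q)) p =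
    ev2 (g a p) (nabla D a X Y p) (Z p) + ev2 (g a p) (Y p) (nabla D a X Z p).

Definition levi_civita g D : Prop := torsion_free D /\ metric_connection g D.

(* R(X,Y)Z = nabla_X nabla_Y Z - nabla_Y nabla_X Z - nabla_[X,Y] Z *)
Definition curvature D a X Y Z : M -> 'rV[R]_m := fun p =>
  nabla D a X (nabla D a Y Z) p - nabla D a Y (nabla D a X Z) p
  - nabla D a (bracket a X Y) Z p.

(* Ric(Y,Z) = tr (X |-> R(X,Y)Z) *)
Definition ricci D a p : 'M[R]_m :=
  \matrix_(i, j) \sum_k curvature D a (frame k) (frame i) (frame j) p 0 k.

(* The trace of Ric with respect to g. It does not depend on the chart a,
   provided p is in dom a. *)
Definition scalar_curvature g D a p : R := \tr (invmx (g a p) *m ricci D a p).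

(* Hess f (X,Y) = X(Y f) - (nabla_X Y) f *)
Definition hessian D (f : M -> R) a p : 'M[R]_m :=
  \matrix_(i, j) (along a (frame i) (along a (frame j) f) p
                  - along a (nabla D a (frame i) (frame j)) f p).

(* (nabla_X phi) Y = nabla_X (phi Y) - phi (nabla_X Y) *)
Definition nabla11 D phi a X Y : M -> 'rV[R]_m := fun p =>
  nabla D a X (fun q => Y q *m phi a q) p - nabla D a X Y p *m phi a p.

Definition kenmotsu D phi (xi : chart M -> M -> 'rV[R]_m)
    (eta : chart M -> M -> 'cV[R]_m) g : Prop :=
  [/\ almost_contact_metric phi xi eta g, levi_civita g D &
    forall a X Y, local_field a (dom a) X -> local_field a (dom a) Y ->
    forall p, dom a p ->
      nabla11 D phi a X Y p =
      ev2 (g a p) (X p *m phi a p) (Y p) *: xi a p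
      - ev1 (eta a p) (Y p) *: (X p *m phi a p)].

Definition gradient_almost_eta_ricci_soliton D g
    (eta : chart M -> M -> 'cV[R]_m) (f lam mu : M -> R) : Prop :=
  [/\ smooth f, smooth lam, smooth mu &
    forall a p, dom a p ->
      hessian D f a p + ricci D a p + lam p *: g a p
      + mu p *: (eta a p *m (eta a p)^T) = 0].

Definition einstein D g : Prop :=
  exists c : R, forall a p, dom a p -> ricci D a p = c *: g a p.

End Riemannian.

(* Main.v *)
Require Import Defs.
From HB Require Import structures.
From mathcomp Require Import all_boot all_order all_algebra.
From mathcomp Require Import all_classical all_reals all_analysis.
From mathcomp Require Import ring lra.

(** On a Kenmotsu manifold the structure equation forces
    [nabla_X xi = X - eta(X) xi] ([nab_reeb]). This determines the curvature in
    the direction of the Reeb field: [R(X,Y)xi = eta(X)Y - eta(Y)X], and by the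
    pair symmetry [R(X,xi)Z = g(X,Z)xi - eta(Z)X] ([curv_xi], [curv_xim]).
    Differentiating the last formula and using the second Bianchi identity one
    finds, after contraction ([dric_xi]),
      [nabla_xi Ric = - 2 (Ric + 2n g)].                                (1)

    The soliton equation enters through the Ricci identity
    [(nabla_xi Hess f)(Y,Z) - (nabla_Y Hess f)(xi,Z) = - df(R(xi,Y)Z)].
    When [Hess f] is replaced by [- Ric - lambda g - mu eta (x) eta], the
    derivatives of [Ric] are known from (1) and from [Ric(xi,-) = - 2n eta], so
    that an algebraic equation for [Ric] remains. It gives ([ric_soliton])
      [Ric = alpha g - (2n + alpha) eta (x) eta],                       (2)
    where [alpha = xi(f) + xi(lambda) - mu - 2n].

    Since [g] and [eta] are parallel along [xi], (1) and (2) together give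
    [xi(alpha) (g - eta (x) eta) = - 2 (Ric + 2n g)] ([lie_soliton_factor]). On
    the other hand the trace of (2) is [r = 2n (alpha - 1)]. If [n > 0] then
    [xi(r) = 0] implies [xi(alpha) = 0], hence [Ric = - 2n g], and the trace of
    this is [r = - 2n (2n + 1)]. If [n = 0] the manifold is one-dimensional and
    its curvature vanishes.

    All identities up to this point are polynomial identities between functions
    in one chart and their derivatives. They are proved over an arbitrary
    commutative ring [A] in place of the smooth functions, with rows over [A] in
    place of the vector fields ([torsion_free_connection]). To apply them, the
    smooth functions on a chart domain are made into a ring with commuting
    derivations ([smooth_fun], [chart_deriv]). The analysis needed for this is
    that smooth functions are closed under the ring operations
    ([smooth_polyP]), and the symmetry of second derivatives ([schwarz]). *)

Set Implicit Arguments.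
Unset Strict Implicit.
Unset Printing Implicit Defensive.
Import Order.TTheory GRing.Theory Num.Theory.
Import numFieldNormedType.Exports.
Local Open Scope ring_scope.

(** * Torsion-free connections over a commutative ring *)

(** The ring [A] plays the part of the smooth functions on a chart domain, row
    vectors that of the vector fields, [lie X f] that of [X(f)].
    Torsion-freeness is built in: the Lie bracket does not occur,
    [nab U V - nab V U] is used in its place, and is required to act as the
    commutator of derivations and to satisfy the Jacobi identity. Both
    requirements are needed, since nothing says that a row vector is determined
    by the derivation that it induces. *)
Record torsion_free_connection (A : comPzRingType) (m : nat)
    (lie : 'rV[A]_m -> A -> A) (nab : 'rV[A]_m -> 'rV[A]_m -> 'rV[A]_m) :
    Prop := TorsionFreeConnection {
  tfc_lieDl : forall X Y f, lie (X + Y) f = lie X f + lie Y f;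
  tfc_lieZl : forall c X f, lie (c *: X) f = c * lie X f;
  tfc_lieD : forall X f h, lie X (f + h) = lie X f + lie X h;
  tfc_lieM : forall X f h, lie X (f * h) = lie X f * h + f * lie X h;
  tfc_lie_comm : forall X Y f,
    lie (nab X Y - nab Y X) f = lie X (lie Y f) - lie Y (lie X f);
  tfc_nabDl : forall X Y Z, nab (X + Y) Z = nab X Z + nab Y Z;
  tfc_nabZl : forall c X Z, nab (c *: X) Z = c *: nab X Z;
  tfc_nabDr : forall X Y Z, nab X (Y + Z) = nab X Y + nab X Z;
  tfc_nabZr : forall X c Y, nab X (c *: Y) = lie X c *: Y + c *: nab X Y;
  tfc_jacobi : forall X Y Z,
    let br U V := nab U V - nab V U in
    br X (br Y Z) + br Y (br Z X) + br Z (br X Y) = 0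
}.

(** * Linear maps and traces over a commutative ring *)

Section Trace.
Context {A : comPzRingType} {m : nat}.
Implicit Types T : 'rV[A]_m -> 'rV[A]_m.

Definition trace T : A := \sum_k T (delta_mx 0 k) 0 k.

Lemma eq_trace T T' : T =1 T' -> trace T = trace T'.
Proof. by move=> TT'; apply: eq_bigr => k _; rewrite TT'. Qed.

Lemma traceD T T' : trace (fun X => T X + T' X) = trace T + trace T'.
Proof. by rewrite /trace -big_split; apply: eq_bigr => k _; rewrite mxE. Qed.

Lemma traceZ c T : trace (fun X => c *: T X) = c * trace T.
Proof. by rewrite /trace mulr_sumr; apply: eq_bigr => k _; rewrite mxE. Qed.

Lemma trace_id : trace id = m%:R.
Proof.
rewrite /trace (eq_bigr (fun=> 1)); last by move=> k _; rewrite mxE !eqxx.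
by rewrite sumr_const card_ord.
Qed.

Lemma additive_sum (U V : nmodType) (I : Type) (s : seq I) (u : I -> U)
    (h : U -> V) :
  h 0 = 0 -> (forall x y, h (x + y) = h x + h y) ->
  h (\sum_(i <- s) u i) = \sum_(i <- s) h (u i).
Proof. by move=> h0 hD; apply: (big_morph h hD h0). Qed.

Lemma additive0 (U V : zmodType) (h : U -> V) :
  (forall x y, h (x + y) = h x + h y) -> h 0 = 0.
Proof. by move=> hD; apply: (addrI (h 0)); rewrite -hD !addr0. Qed.

Lemma linear_expand (h : 'rV[A]_m -> A) (u : 'rV[A]_m) :
  (forall x y, h (x + y) = h x + h y) -> (forall c x, h (c *: x) = c * h x) ->
  h u = \sum_j u 0 j * h (delta_mx 0 j).
Proof.
move=> hD hZ; rewrite {1}(row_sum_delta u).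
by rewrite (additive_sum _ _ (additive0 hD) hD); apply: eq_bigr => j _.
Qed.

Lemma bilinear_eq0 (B : 'rV[A]_m -> 'rV[A]_m -> A) :
  (forall X X' Y, B (X + X') Y = B X Y + B X' Y) ->
  (forall c X Y, B (c *: X) Y = c * B X Y) ->
  (forall X Y Y', B X (Y + Y') = B X Y + B X Y') ->
  (forall c X Y, B X (c *: Y) = c * B X Y) ->
  (forall i j, B (delta_mx 0 i) (delta_mx 0 j) = 0) -> forall X Y, B X Y = 0.
Proof.
move=> BDl BZl BDr BZr B0 X Y.
rewrite (linear_expand (h := B^~ Y)) //= big1 // => i _.
rewrite (linear_expand (h := B _)) //= big1 ?mulr0 // => j _.
by rewrite B0 mulr0.
Qed.

Lemma trace_rank1 (h : 'rV[A]_m -> A) (u : 'rV[A]_m) :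
  (forall x y, h (x + y) = h x + h y) -> (forall c x, h (c *: x) = c * h x) ->
  trace (fun X => h X *: u) = h u.
Proof.
move=> hD hZ; rewrite (linear_expand u hD hZ).
by apply: eq_bigr => j _; rewrite mxE mulrC.
Qed.

(** For a derivation [delta] over [D], the matrix of [delta \o T - T \o delta]
    is the entrywise [D] of the matrix of [T] plus a commutator of two matrices,
    and a commutator has trace zero. With [delta] a covariant derivative this
    says that covariant differentiation commutes with contraction. *)
Lemma trace_commutator (D : A -> A) (delta T : 'rV[A]_m -> 'rV[A]_m) :
  (forall f h, D (f + h) = D f + D h) ->
  (forall X Y, delta (X + Y) = delta X + delta Y) ->
  (forall c X, delta (c *: X) = D c *: X + c *: delta X) ->
  (forall X Y, T (X + Y) = T X + T Y) ->
  (forall c X, T (c *: X) = c *: T X) ->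
  trace (fun X => delta (T X) - T (delta X)) = D (trace T).
Proof.
move=> DD deltaD deltaZ TD TZ.
pose e k : 'rV[A]_m := delta_mx 0 k.
have deltaE k j : delta (T (e k)) 0 j
    = D (T (e k) 0 j) + \sum_i T (e k) 0 i * delta (e i) 0 j.
  rewrite {1}(row_sum_delta (T (e k))).
  rewrite (additive_sum _ _ (additive0 deltaD) deltaD) summxE.
  under eq_bigr do rewrite deltaZ mxE [X in X + _]mxE [X in _ + X]mxE.
  rewrite big_split /=; congr (_ + _).
  rewrite (bigD1 j) //= mxE !eqxx mulr1 big1 ?addr0 // => i ij.
  by rewrite mxE eqxx eq_sym (negbTE ij) mulr0.
have TE k j : T (delta (e k)) 0 j = \sum_i delta (e k) 0 i * T (e i) 0 j.
  rewrite (linear_expand (h := fun X => T X 0 j)) => // [x y|c x].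
    by rewrite TD mxE.
  by rewrite TZ mxE.
rewrite /trace (additive_sum _ _ (additive0 DD) DD).
under eq_bigr do rewrite mxE [X in _ + X]mxE deltaE TE.
rewrite !big_split /= sumrN -addrA [X in _ + X](_ : _ = 0) ?addr0 //.
apply/eqP; rewrite subr_eq0 exchange_big /=; apply/eqP.
by apply: eq_bigr => k _; apply: eq_bigr => i _; rewrite mulrC.
Qed.

End Trace.

(** * Curvature, Ricci tensor and the Kenmotsu identities *)

Section Curvature.
Context {A : comPzRingType} {m : nat}.
Context (lie : 'rV[A]_m -> A -> A) (nab : 'rV[A]_m -> 'rV[A]_m -> 'rV[A]_m).
Context (conn : torsion_free_connection lie nab).
Implicit Types (X Y Z W : 'rV[A]_m) (f c : A).

Let lieDl := tfc_lieDl conn.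
Let lieZl := tfc_lieZl conn.
Let lieD := tfc_lieD conn.
Let lieM := tfc_lieM conn.
Let nabDl := tfc_nabDl conn.
Let nabZl := tfc_nabZl conn.
Let nabDr := tfc_nabDr conn.
Let nabZr := tfc_nabZr conn.

Lemma lie0 X : lie X 0 = 0.
Proof. exact: additive0 (lieD X). Qed.

Lemma lie1 X : lie X 1 = 0.
Proof.
have := lieM X 1 1; rewrite !mulr1 mul1r => E.
by apply: (addrI (lie X 1)); rewrite addr0 -E.
Qed.

Lemma lieN X f : lie X (- f) = - lie X f.
Proof. by apply: (addrI (lie X f)); rewrite -lieD !subrr lie0. Qed.

Lemma lie_nat X k : lie X k%:R = 0.
Proof. by elim: k => [|k IH]; rewrite ?lie0 // -natr1 lieD IH lie1 addr0. Qed.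

Lemma lieNl X f : lie (- X) f = - lie X f.
Proof. by rewrite -scaleN1r lieZl mulN1r. Qed.

Lemma nabNl X Y : nab (- X) Y = - nab X Y.
Proof. by rewrite -scaleN1r nabZl scaleN1r. Qed.

Lemma nabNr X Y : nab X (- Y) = - nab X Y.
Proof.
by rewrite -scaleN1r nabZr lieN lie1 oppr0 scale0r add0r scaleN1r.
Qed.

Definition curv X Y Z : 'rV[A]_m :=
  nab X (nab Y Z) - nab Y (nab X Z) - nab (nab X Y - nab Y X) Z.

Let linE :=
  (nabDl, nabNl, nabZl, nabDr, nabNr, nabZr, lieDl, lieNl, lieZl, lieD, lieN,
   lieM).

Lemma curvC X Y Z : curv X Y Z = - curv Y X Z.
Proof. by rewrite /curv !linE; apply/rowP => k; rewrite !mxE; ring. Qed.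

Lemma curvXX X Z : (forall f : A, f + f = 0 -> f = 0) -> curv X X Z = 0.
Proof.
move=> dbl_inj; apply/rowP => k; rewrite [RHS]mxE; apply: dbl_inj.
by rewrite {2}curvC [X in _ + X]mxE subrr.
Qed.

Lemma curvDl X X' Y Z : curv (X + X') Y Z = curv X Y Z + curv X' Y Z.
Proof. by rewrite /curv !linE; apply/rowP => k; rewrite !mxE; ring. Qed.

Lemma curvZl c X Y Z : curv (c *: X) Y Z = c *: curv X Y Z.
Proof. by rewrite /curv !linE; apply/rowP => k; rewrite !mxE; ring. Qed.

Lemma curvDm X Y Y' Z : curv X (Y + Y') Z = curv X Y Z + curv X Y' Z.
Proof. by rewrite curvC curvDl opprD -!curvC. Qed.

Lemma curvZm c X Y Z : curv X (c *: Y) Z = c *: curv X Y Z.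
Proof. by rewrite curvC curvZl -scalerN -curvC. Qed.

Lemma curvDr X Y Z Z' : curv X Y (Z + Z') = curv X Y Z + curv X Y Z'.
Proof. by rewrite /curv !linE; apply/rowP => k; rewrite !mxE; ring. Qed.

(** Here, unlike in the other two arguments, second derivatives of [c] appear;
    they cancel because the bracket acts as a commutator. *)
Lemma curvZr c X Y Z : curv X Y (c *: Z) = c *: curv X Y Z.
Proof.
have E := tfc_lie_comm conn X Y c; rewrite lieDl lieNl in E.
apply/rowP => k; rewrite /curv !linE !mxE.
have -> : lie (nab X Y) c
    = lie (nab Y X) c + (lie X (lie Y c) - lie Y (lie X c)).
  by rewrite -E; ring.
ring.
Qed.

(** The expansion is the Jacobi identity, by absence of torsion. *)
Lemma bianchi1 X Y Z : curv X Y Z + curv Y Z X + curv Z X Y = 0.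
Proof.
have := tfc_jacobi conn X Y Z; rewrite /= !linE => J.
by rewrite /curv !linE -[RHS]J; apply/rowP => k; rewrite !mxE; ring.
Qed.

(** The covariant derivative of the curvature, [(nabla_X R)(Y, Z) W]. *)
Definition dcurv X Y Z W : 'rV[A]_m :=
  nab X (curv Y Z W) - curv (nab X Y) Z W - curv Y (nab X Z) W
  - curv Y Z (nab X W).

(** After expansion the third covariant derivatives cancel in pairs, and what is
    left is the Jacobi identity with [nab] applied to it. *)
Lemma bianchi2 X Y Z W : dcurv X Y Z W + dcurv Y Z X W + dcurv Z X Y W = 0.
Proof.
have /(congr1 (fun v => nab v W)) := tfc_jacobi conn X Y Z.
rewrite /= -[in RHS](scale0r W) nabZl scale0r => J.
rewrite -[RHS]oppr0 -J /dcurv /curv !linE.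
by apply/rowP => k; rewrite !mxE; ring.
Qed.

Definition ric Y Z : A := trace (fun X => curv X Y Z).

Lemma ricDl Y Y' Z : ric (Y + Y') Z = ric Y Z + ric Y' Z.
Proof. by rewrite -traceD; apply: eq_trace => X; rewrite curvDm. Qed.

Lemma ricZl c Y Z : ric (c *: Y) Z = c * ric Y Z.
Proof. by rewrite -traceZ; apply: eq_trace => X; rewrite curvZm. Qed.

Lemma ricDr Y Z Z' : ric Y (Z + Z') = ric Y Z + ric Y Z'.
Proof. by rewrite -traceD; apply: eq_trace => X; rewrite curvDr. Qed.

Lemma ricZr c Y Z : ric Y (c *: Z) = c * ric Y Z.
Proof. by rewrite -traceZ; apply: eq_trace => X; rewrite curvZr. Qed.

(** The left-hand side is [(nabla_X Ric)(Y, Z)]. *)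
Lemma dric_trace X Y Z :
  lie X (ric Y Z) - ric (nab X Y) Z - ric Y (nab X Z)
  = trace (fun U => dcurv X U Y Z).
Proof.
rewrite -(@trace_commutator _ _ (lie X) (nab X)) //; first last.
- by move=> c U; rewrite curvZl.
- by move=> U V; rewrite curvDl.
rewrite -mulN1r -[- ric Y _]mulN1r -!traceZ -!traceD.
apply: eq_trace => U; rewrite /dcurv; apply/rowP => k; rewrite !mxE; ring.
Qed.

Definition hess f X Y : A := lie X (lie Y f) - lie (nab X Y) f.

Lemma hessDl f X X' Y : hess f (X + X') Y = hess f X Y + hess f X' Y.
Proof. by rewrite /hess !linE; ring. Qed.

Lemma hessZl f c X Y : hess f (c *: X) Y = c * hess f X Y.
Proof. by rewrite /hess !linE; ring. Qed.

Lemma hessDr f X Y Y' : hess f X (Y + Y') = hess f X Y + hess f X Y'.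
Proof. by rewrite /hess !linE; ring. Qed.

Lemma hessZr f c X Y : hess f X (c *: Y) = c * hess f X Y.
Proof. by rewrite /hess !linE; ring. Qed.

(** The commutation rule for second covariant derivatives of the one-form [df].
    Working with [df] and not with the gradient of [f] avoids the inverse of the
    metric. *)
Lemma ricci_identity f X Y Z :
  (lie X (hess f Y Z) - hess f (nab X Y) Z - hess f Y (nab X Z))
  - (lie Y (hess f X Z) - hess f (nab Y X) Z - hess f X (nab Y Z))
  = - lie (curv X Y Z) f.
Proof.
have E1 := tfc_lie_comm conn X Y (lie Z f).
rewrite lieDl lieNl in E1.
rewrite /hess /curv !linE.
have -> : lie X (lie Y (lie Z f)) = lie (nab X Y) (lie Z f)
   - lie (nab Y X) (lie Z f) + lie Y (lie X (lie Z f)).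
  by rewrite E1; ring.
ring.
Qed.

Context (g : 'rV[A]_m -> 'rV[A]_m -> A).
Context (gC : forall X Y, g X Y = g Y X).
Context (gD : forall X Y Z, g (X + Y) Z = g X Z + g Y Z).
Context (gZ : forall c X Y, g (c *: X) Y = c * g X Y).
Context (g_metric : forall X Y Z,
  lie X (g Y Z) = g (nab X Y) Z + g Y (nab X Z)).
Context (dbl_inj : forall f : A, f + f = 0 -> f = 0).

Lemma gDr X Y Z : g X (Y + Z) = g X Y + g X Z.
Proof. by rewrite gC gD !(gC X). Qed.

Lemma gZr c X Y : g X (c *: Y) = c * g X Y.
Proof. by rewrite gC gZ gC. Qed.

Lemma gN X Y : g (- X) Y = - g X Y.
Proof. by rewrite -scaleN1r gZ mulN1r. Qed.

Lemma gNr X Y : g X (- Y) = - g X Y.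
Proof. by rewrite gC gN gC. Qed.

Let gE := (gD, gDr, gZ, gZr, gN, gNr).

Lemma curv_skew X Y Z W : g (curv X Y Z) W = - g Z (curv X Y W).
Proof.
have := tfc_lie_comm conn X Y (g Z W).
rewrite lieDl lieNl !g_metric !lieD !g_metric => E.
rewrite /curv !nabDl !nabNl !gE.
apply/eqP; rewrite -subr_eq0 opprK; apply/eqP.
move/eqP: E; rewrite -subr_eq0 => /eqP E; rewrite -[RHS]oppr0 -E; ring.
Qed.

(** The usual octahedron argument: an alternating sum of the four first Bianchi
    identities on [X, Y, Z, W] is twice the difference of the two sides. *)
Lemma curv_pair X Y Z W : g (curv X Y Z) W = g (curv Z W X) Y.
Proof.
have B x y z w : g (curv x y z) w + g (curv y z x) w + g (curv z x y) w = 0.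
  by rewrite -!gD bianchi1 -(scale0r 0) gZ mul0r.
have C x y z w : g (curv x y z) w = - g (curv y x z) w by rewrite curvC gN.
have S x y z w : g (curv x y z) w = - g (curv x y w) z.
  by rewrite curv_skew gC.
apply/eqP; rewrite -subr_eq0; apply/eqP/dbl_inj.
have b1 := B X Y Z W.
have := B Y Z W X.
rewrite (S Y Z W X) (S Z W Y X) (C W Y Z X) (S Y W Z X) => b2.
have := B Z W X Y.
rewrite (S W X Z Y) (C X Z W Y) (S Z X W Y) => b3.
have := B W X Y Z; rewrite (S X Y W Z) => b4.
(* The combination b1 - b4 + b2 - b3 is twice the difference; the zeros below
   stand for these four vanishing sums, in that order. *)
transitivity (0 - 0 + 0 - 0 : A); last by ring.
rewrite -{1}b1 -{1}b4 -{1}b2 -{1}b3; ring.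
Qed.

Context (g_nondeg : forall X Y, (forall W, g X W = g Y W) -> X = Y).
Context (xi : 'rV[A]_m) (g_xi : g xi xi = 1).

Let eta X : A := g X xi.

Lemma eta_nab_xi X : eta (nab X xi) = 0.
Proof.
by apply: dbl_inj; rewrite {2}/eta gC -g_metric g_xi lie1.
Qed.

(** Applying the structure equation to [Y = xi], where [phi xi = 0], shows that
    [phi (nab X xi) = phi X]; as [phi] is injective on the kernel of [eta], and
    [nab X xi] lies in that kernel because [xi] has constant length, this
    determines [nab X xi]. *)
Lemma nab_reeb (phi : 'rV[A]_m -> 'rV[A]_m) :
  (forall X Y, phi (X + Y) = phi X + phi Y) ->
  (forall c X, phi (c *: X) = c *: phi X) ->
  (forall X, phi (phi X) = - X + eta X *: xi) ->
  phi xi = 0 ->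
  (forall X, eta (phi X) = 0) ->
  (forall X, nab X (phi xi) - phi (nab X xi)
     = g (phi X) xi *: xi - g xi xi *: phi X) ->
  forall X, nab X xi = X - eta X *: xi.
Proof.
move=> phiD phiZ phi2 phi_xi eta_phi nab_phi X.
have := nab_phi X; rewrite phi_xi -[g (phi X) xi]/(eta (phi X)) eta_phi g_xi.
rewrite (additive0 (nabDr X)) scale0r scale1r !sub0r => /oppr_inj E.
have := congr1 phi E; rewrite !phi2 eta_nab_xi scale0r addr0 => /(congr1 -%R).
by rewrite opprK opprD opprK.
Qed.

Context (nab_xi : forall X, nab X xi = X - eta X *: xi).

Lemma eta_xi : eta xi = 1. Proof. exact: g_xi. Qed.

Lemma etaD X Y : eta (X + Y) = eta X + eta Y.
Proof. exact: gD. Qed.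

Lemma etaZ c X : eta (c *: X) = c * eta X.
Proof. exact: gZ. Qed.

Lemma etaN X : eta (- X) = - eta X.
Proof. exact: gN. Qed.

Lemma lie_eta X Y : lie X (eta Y) = eta (nab X Y) + g X Y - eta X * eta Y.
Proof. by rewrite g_metric nab_xi !gE /eta (gC Y X); ring. Qed.

Lemma curv_xi X Y : curv X Y xi = eta X *: Y - eta Y *: X.
Proof.
rewrite /curv !nab_xi !linE !nab_xi !lie_eta etaD etaN (gC Y X).
by apply/rowP => k; rewrite !mxE; ring.
Qed.

(** The metric is used to move [xi] to the third slot, where [curv_xi]
    applies. *)
Lemma curv_xim X Z : curv X xi Z = g X Z *: xi - eta Z *: X.
Proof.
apply: g_nondeg => W; rewrite curv_pair curv_skew curv_xi !gE.
by rewrite /eta (gC xi W); ring.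
Qed.

Lemma dcurvC X Y Z W : dcurv X Y Z W = - dcurv X Z Y W.
Proof.
rewrite /dcurv (curvC Y Z W) (curvC _ Z W) (curvC Y _ W) (curvC Y Z) nabNr.
by apply/rowP => k; rewrite !mxE; ring.
Qed.

(** Differentiating [curv_xim]: the terms where the derivative falls on the
    explicit right-hand side or on [xi] leave the full curvature tensor. *)
Lemma dcurv_xi X Y Z : dcurv X Y xi Z = curv X Y Z + g Y Z *: X - g X Z *: Y.
Proof.
rewrite /dcurv !curv_xim nab_xi curvDm -[- (eta X *: xi)]scaleNr curvZm.
rewrite curv_xim !linE !nab_xi.
rewrite lie_eta g_metric (curvC Y X).
by apply/rowP => k; rewrite !mxE; ring.
Qed.

(** By the second Bianchi identity the derivative in direction [xi] is expressed
    through derivatives of the kind treated in [dcurv_xi]. *)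
Lemma dcurv_xil X Y Z :
  dcurv xi X Y Z = (- 2%:R) *: (curv X Y Z + g Y Z *: X - g X Z *: Y).
Proof.
have := bianchi2 xi X Y Z; rewrite dcurv_xi (dcurvC Y xi X) dcurv_xi => /eqP.
rewrite -addrA addr_eq0 => /eqP ->; rewrite (curvC Y X).
by apply/rowP => k; rewrite !mxE; ring.
Qed.

Let N : A := m%:R - 1.

Lemma ric_xi Y : ric Y xi = - N * eta Y.
Proof.
rewrite /ric (eq_trace (fun X => curv_xi X Y)).
rewrite (eq_trace (T' := fun X => eta X *: Y + (- eta Y) *: X)); last first.
  by move=> X; rewrite scaleNr.
rewrite traceD (trace_rank1 _ etaD etaZ) traceZ trace_id /N; ring.
Qed.

Lemma ric_xil Z : ric xi Z = - N * eta Z.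
Proof.
rewrite /ric (eq_trace (fun X => curv_xim X Z)).
rewrite (eq_trace (T' := fun X => g X Z *: xi + (- eta Z) *: X)); last first.
  by move=> X; rewrite scaleNr.
rewrite traceD trace_rank1 //= traceZ trace_id /N (gC xi Z) -/(eta Z).
ring.
Qed.

(** The contraction of [dcurv_xil]. It says that [Ric + N g] decays like
    [exp (-2t)] along the flow lines of [xi]. *)
Lemma dric_xi Y Z :
  lie xi (ric Y Z) - ric (nab xi Y) Z - ric Y (nab xi Z)
  = - 2%:R * (ric Y Z + N * g Y Z).
Proof.
rewrite dric_trace (eq_trace (fun X => dcurv_xil X Y Z)) traceZ; congr (_ * _).
rewrite (eq_trace
  (T' := fun X => curv X Y Z + (g Y Z *: X + (- 1) *: (g X Z *: Y)))).
  rewrite traceD -/(ric Y Z) traceD !traceZ trace_id trace_rank1 //= /N; ring.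
by move=> X; rewrite scaleN1r addrA.
Qed.

Section Soliton.
Context (f lam mu : A).
Context (soliton_frame : forall i j,
  let e k : 'rV[A]_m := delta_mx 0 k in
  hess f (e i) (e j) + ric (e i) (e j) + lam * g (e i) (e j)
  + mu * (eta (e i) * eta (e j)) = 0).

Lemma soliton Y Z :
  hess f Y Z + ric Y Z + lam * g Y Z + mu * (eta Y * eta Z) = 0.
Proof.
move: Y Z; apply: bilinear_eq0 => //.
- by move=> *; rewrite hessDl ricDl gD etaD; ring.
- by move=> *; rewrite hessZl ricZl gZ etaZ; ring.
- by move=> *; rewrite hessDr ricDr gDr etaD; ring.
- by move=> *; rewrite hessZr ricZr gZr etaZ; ring.
Qed.

(** The coefficient of the metric in the Ricci tensor of a soliton; see
    [ric_soliton]. *)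
Definition soliton_factor : A := lie xi f + lie xi lam - mu - N.
Let al := soliton_factor.

Lemma soliton_hess Y Z :
  hess f Y Z = - (ric Y Z + lam * g Y Z + mu * (eta Y * eta Z)).
Proof. by apply/eqP; rewrite -addr_eq0 !addrA soliton. Qed.

Lemma lie_N X : lie X N = 0.
Proof. by rewrite /N lieD lieN lie1 lie_nat subrr. Qed.

(** The Ricci identity for [f] with first argument [xi], the Hessian being
    eliminated by the soliton equation. The derivatives of [Ric] that remain are
    [nabla_xi Ric], known from [dric_xi], and [(nabla_Y Ric)(xi, Z)], known
    because [Ric(xi, -)] is a multiple of [eta]; both are algebraic in [Ric],
    with total coefficient one. *)
Lemma ric_soliton_one_form Y Z :
  ric Y Z = al * g Y Z
  + (lie xi mu * eta Y + mu * eta Y - lie Y f - lie Y lam - lie Y mu) * eta Z.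
Proof.
have dN : lie Y (- N * eta Z) = - N * lie Y (eta Z).
  by rewrite lieM lieN lie_N oppr0 mul0r add0r.
have gxi W : g xi W = eta W by rewrite gC.
have := ricci_identity f xi Y Z.
rewrite curvC curv_xim !soliton_hess !ric_xil nab_xi.
rewrite ricDl -[- (eta Y *: xi)]scaleNr ricZl ric_xil.
rewrite !(dN, lieN, lieD, lieM, gxi, lieDl, lieNl, lieZl).
rewrite -[lie xi (ric Y Z)](subrK (ric (nab xi Y) Z)).
rewrite -[lie xi (ric Y Z) - _](subrK (ric Y (nab xi Z))) dric_xi eta_xi lie1.
rewrite !lie_eta !g_metric.
rewrite !(etaD, etaN, etaZ, gE, gxi, eta_xi, nab_xi).
rewrite /al /soliton_factor => /eqP; rewrite -subr_eq0 => /eqP E.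
by apply/eqP; rewrite -subr_eq0 -[X in _ == X]E; apply/eqP; ring.
Qed.

(** The unknown one-form of [ric_soliton_one_form] is found by evaluating at
    [Z = xi], where the Ricci tensor is known. *)
Lemma ric_soliton Y Z : ric Y Z = al * g Y Z - (N + al) * (eta Y * eta Z).
Proof.
have := ric_soliton_one_form Y xi; rewrite ric_xi eta_xi mulr1 => E.
rewrite ric_soliton_one_form.
suff -> : lie xi mu * eta Y + mu * eta Y - lie Y f - lie Y lam - lie Y mu
    = - (N + al) * eta Y by ring.
by rewrite mulNr mulrDl opprD -mulNr E /eta; ring.
Qed.

(** Since [g] and [eta] are parallel along [xi], differentiating [ric_soliton]
    along [xi] hits the coefficients only; the result is compared with
    [dric_xi]. *)
Lemma lie_soliton_factor Y Z :
  lie xi al * (g Y Z - eta Y * eta Z) = - 2%:R * (ric Y Z + N * g Y Z).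
Proof.
have dN : lie xi (N + al) = lie xi al by rewrite lieD lie_N add0r.
rewrite -dric_xi !ric_soliton [lie xi (_ * _ - _)]lieD lieN !lieM dN.
rewrite !lie_eta g_metric eta_xi.
by rewrite ![g xi _]gC -!/(eta _); ring.
Qed.

End Soliton.

End Curvature.

(** * Connections given by Christoffel symbols *)

Section Coordinates.
Context {A : comPzRingType} {m : nat} (d : 'I_m -> A -> A).
Context (dD : forall i f h, d i (f + h) = d i f + d i h).
Context (dM : forall i f h, d i (f * h) = d i f * h + f * d i h).
Context (dC : forall i j f, d i (d j f) = d j (d i f)).
Context (G : 'I_m -> 'I_m -> 'rV[A]_m).
Implicit Types (X Y Z : 'rV[A]_m) (f h c : A).

Definition coord_lie X f : A := \sum_i X 0 i * d i f.

Definition coord_symbol X Y : 'rV[A]_m :=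
  \sum_i \sum_j (X 0 i * Y 0 j) *: G i j.

Definition coord_nabla X Y : 'rV[A]_m :=
  (\row_k coord_lie X (Y 0 k)) + coord_symbol X Y.

Definition coord_bracket X Y : 'rV[A]_m :=
  \row_k (coord_lie X (Y 0 k) - coord_lie Y (X 0 k)).

Lemma coord_lieDl X Y f : coord_lie (X + Y) f = coord_lie X f + coord_lie Y f.
Proof.
by rewrite /coord_lie -big_split; apply: eq_bigr => i _; rewrite mxE mulrDl.
Qed.

Lemma coord_lieZl c X f : coord_lie (c *: X) f = c * coord_lie X f.
Proof. by rewrite mulr_sumr; apply: eq_bigr => i _; rewrite mxE mulrA. Qed.

Lemma coord_lieD X f h : coord_lie X (f + h) = coord_lie X f + coord_lie X h.
Proof.
by rewrite /coord_lie -big_split; apply: eq_bigr => i _; rewrite dD mulrDr.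
Qed.

Lemma coord_lieM X f h :
  coord_lie X (f * h) = coord_lie X f * h + f * coord_lie X h.
Proof.
rewrite /coord_lie mulr_suml mulr_sumr -big_split; apply: eq_bigr => i _.
by rewrite dM /=; ring.
Qed.

Lemma coord_lieN X f : coord_lie X (- f) = - coord_lie X f.
Proof.
apply: (addrI (coord_lie X f)); rewrite -coord_lieD !subrr.
exact: additive0 (coord_lieD X).
Qed.

Lemma coord_lie_bracket X Y f : coord_lie (coord_bracket X Y) f
  = coord_lie X (coord_lie Y f) - coord_lie Y (coord_lie X f).
Proof.
have E U V : coord_lie U (coord_lie V f)
    = \sum_i coord_lie U (V 0 i) * d i f
      + \sum_i \sum_j (U 0 i * V 0 j) * d i (d j f).
  rewrite {2}/coord_lie (additive_sum _ _ (additive0 (coord_lieD U))) //;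
    last exact: coord_lieD.
  under eq_bigr do rewrite coord_lieM.
  rewrite big_split exchange_big; congr (_ + _); apply: eq_bigr => i _ /=.
  by rewrite mulr_sumr; apply: eq_bigr => j _; ring.
rewrite !E [X in _ - (_ + X)]exchange_big /=.
have -> : \sum_j \sum_i (Y 0 i * X 0 j) * d i (d j f)
    = \sum_i \sum_j (X 0 i * Y 0 j) * d i (d j f).
  by apply: eq_bigr => i _; apply: eq_bigr => j _; rewrite dC; ring.
rewrite opprD addrACA subrr addr0 -sumrB; apply: eq_bigr => i _.
by rewrite mxE mulrBl.
Qed.

Lemma coord_jacobi X Y Z :
  let br := coord_bracket in br X (br Y Z) + br Y (br Z X) + br Z (br X Y) = 0.
Proof.
apply/rowP => k; rewrite !mxE !coord_lie_bracket !(coord_lieD, coord_lieN).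
ring.
Qed.

Lemma coord_symbolDl X X' Y :
  coord_symbol (X + X') Y = coord_symbol X Y + coord_symbol X' Y.
Proof.
rewrite /coord_symbol -big_split; apply: eq_bigr => i _ /=.
rewrite -big_split; apply: eq_bigr => j _ /=.
by rewrite mxE mulrDl scalerDl.
Qed.

Lemma coord_symbolZl c X Y : coord_symbol (c *: X) Y = c *: coord_symbol X Y.
Proof.
rewrite /coord_symbol scaler_sumr; apply: eq_bigr => i _.
rewrite scaler_sumr; apply: eq_bigr => j _.
by rewrite mxE scalerA mulrA.
Qed.

Lemma coord_symbolDr X Y Y' :
  coord_symbol X (Y + Y') = coord_symbol X Y + coord_symbol X Y'.
Proof.
rewrite /coord_symbol -big_split; apply: eq_bigr => i _ /=.
rewrite -big_split; apply: eq_bigr => j _ /=.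
by rewrite mxE mulrDr scalerDl.
Qed.

Lemma coord_symbolZr c X Y : coord_symbol X (c *: Y) = c *: coord_symbol X Y.
Proof.
rewrite /coord_symbol scaler_sumr; apply: eq_bigr => i _.
rewrite scaler_sumr; apply: eq_bigr => j _.
by rewrite mxE scalerA mulrCA.
Qed.

(** The derivations [d i] have to commute: this is what makes the coordinate
    bracket act as a commutator and satisfy the Jacobi identity. *)
Lemma coord_connection :
  (forall X Y, coord_nabla X Y - coord_nabla Y X = coord_bracket X Y) ->
  torsion_free_connection coord_lie coord_nabla.
Proof.
move=> torsion; split.
- exact: coord_lieDl.
- exact: coord_lieZl.
- exact: coord_lieD.
- exact: coord_lieM.
- by move=> X Y f; rewrite torsion coord_lie_bracket.
- move=> X Y Z; rewrite /coord_nabla coord_symbolDl addrACA; congr (_ + _).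
  by apply/rowP => k; rewrite !mxE coord_lieDl.
- move=> c X Y; rewrite /coord_nabla coord_symbolZl scalerDr; congr (_ + _).
  by apply/rowP => k; rewrite !mxE coord_lieZl.
- move=> X Y Z; rewrite /coord_nabla coord_symbolDr addrACA; congr (_ + _).
  by apply/rowP => k; rewrite !mxE coord_lieD.
- move=> X c Y; rewrite /coord_nabla coord_symbolZr scalerDr addrA.
  congr (_ + _); apply/rowP => k; rewrite !mxE coord_lieM; ring.
- by move=> X Y Z; rewrite /= !torsion coord_jacobi.
Qed.

End Coordinates.

Local Open Scope classical_set_scope.
Local Open Scope ring_scope.

(** * Symmetry of second derivatives *)

Section Schwarz.
Context {R : realType} {V : normedModType R}.
Implicit Types (F : V -> R) (x y u v w : V).

Lemma is_derive_line F u w (s : R) : derivable F (s *: u + w) u ->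
  is_derive s 1 (fun t => F (t *: u + w)) ('D_u F (s *: u + w)).
Proof.
have E : (fun h : R => h^-1 *: (((fun t => F (t *: u + w)) \o shift s) (h *: 1)
      - F (s *: u + w)))
    = (fun h => h^-1 *: ((F \o shift (s *: u + w)) (h *: u) - F (s *: u + w))).
  apply/funext => h /=; congr (_ *: (F _ - _)).
  by rewrite [h *: 1]mulr1 scalerDl addrA.
by move=> dF; apply: DeriveDef; rewrite /derivable /derive E.
Qed.

(** The mean value theorem is applied to the increment of [F] in direction [v],
    as a function of the displacement along [u], and then to the resulting
    increment of ['D_u F]. *)
Lemma second_difference_mvt F x u v (h : R) : 0 < h ->
  (forall s t : R, 0 <= s <= h -> 0 <= t <= h ->
     derivable F (s *: u + (t *: v + x)) u /\
     derivable ('D_u F) (t *: v + (s *: u + x)) v) ->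
  exists s t : R, [/\ 0 <= s <= h, 0 <= t <= h &
    F (h *: u + (h *: v + x)) - F (h *: u + x) - F (h *: v + x) + F x
    = h * h * 'D_v ('D_u F) (s *: u + (t *: v + x))].
Proof.
move=> h0 dF.
have h00 : 0 <= h <= h by apply/andP; split=> //; exact: ltW.
have z0 : (0 : R) <= 0 <= h by apply/andP; split=> //; exact: ltW.
pose phi s := F (s *: u + (h *: v + x)) - F (s *: u + (0 *: v + x)).
pose dphi s := 'D_u F (s *: u + (h *: v + x)) - 'D_u F (s *: u + (0 *: v + x)).
have phiP s : s \in `[0, h] -> is_derive s 1 phi (dphi s).
  rewrite in_itv /= => sh.
  by apply: is_deriveB; apply: is_derive_line;
     [case: (dF s h sh h00)|case: (dF s 0 sh z0)].
have oc s : s \in `]0, h[ -> s \in `[0, h].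
  by apply: subset_itvW.
have c_phi : {within `[0, h], continuous phi}.
  by apply: derivable_within_continuous => r rh; case: (phiP r rh).
have [s sh phiE] :=
  @MVT R phi dphi 0 h h0 (fun r rh => phiP r (oc r rh)) c_phi.
have {oc} sh' : 0 <= s <= h by move/oc : sh; rewrite in_itv.
pose psi t := 'D_u F (t *: v + (s *: u + x)).
pose dpsi t := 'D_v ('D_u F) (t *: v + (s *: u + x)).
have psiP t : t \in `[0, h] -> is_derive t 1 psi (dpsi t).
  by rewrite in_itv /= => th; apply: is_derive_line; case: (dF s t sh' th).
have oc t : t \in `]0, h[ -> t \in `[0, h].
  by apply: subset_itvW.
have c_psi : {within `[0, h], continuous psi}.
  by apply: derivable_within_continuous => r rh; case: (psiP r rh).
have [t th psiE] :=
  @MVT R psi dpsi 0 h h0 (fun r rh => psiP r (oc r rh)) c_psi.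
have {oc} th' : 0 <= t <= h by move/oc : th; rewrite in_itv.
exists s, t; split => //.
have -> : s *: u + (t *: v + x) = t *: v + (s *: u + x) by rewrite addrCA.
transitivity (phi h - phi 0); first by rewrite /phi !scale0r !add0r; ring.
have dphiE : dphi s = psi h - psi 0.
  by rewrite /dphi /psi !scale0r !add0r addrCA.
by rewrite phiE dphiE psiE /dpsi subr0; ring.
Qed.

(** The second difference of [F] is symmetric in [u] and [v], so that
    [second_difference_mvt] shows that the two mixed derivatives take a common
    value at points arbitrarily near [x], although not at the same point.
    Continuity concludes. *)
Lemma schwarz F x u v :
  (\forall y \near x, [/\ derivable F y u, derivable F y v,
     derivable ('D_u F) y v & derivable ('D_v F) y u]) ->
  {for x, continuous ('D_v ('D_u F))} -> {for x, continuous ('D_u ('D_v F))} ->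
  'D_v ('D_u F) x = 'D_u ('D_v F) x.
Proof.
move=> dF cvu cuv; apply/eqP.
rewrite -subr_eq0 -normr_eq0 eq_le normr_ge0 andbT.
apply/ler_addgt0Pl => e e0; rewrite addr0.
have e20 : 0 < e / 2 by rewrite divr_gt0.
have cvu' : \forall y \near x, `|'D_v ('D_u F) x - 'D_v ('D_u F) y| < e / 2.
  by move/cvgrPdist_lt : cvu => /(_ _ e20).
have cuv' : \forall y \near x, `|'D_u ('D_v F) x - 'D_u ('D_v F) y| < e / 2.
  by move/cvgrPdist_lt : cuv => /(_ _ e20).
have : \forall y \near x, [/\ derivable F y u, derivable F y v,
     derivable ('D_u F) y v & derivable ('D_v F) y u] /\
   (`|'D_v ('D_u F) x - 'D_v ('D_u F) y| < e / 2 /\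
    `|'D_u ('D_v F) x - 'D_u ('D_v F) y| < e / 2).
  apply: filterS3 dF cvu' cuv' => y dy yvu yuv; exact: conj dy (conj yvu yuv).
move=> /nbhs_ballP[r /= r0 rP].
pose h := r / (1 + `|u| + `|v|) / 2.
have K0 : 0 < 1 + `|u| + `|v|.
  by rewrite -addrA ltr_pwDl // addr_ge0.
have h0 : 0 < h by rewrite !divr_gt0.
have near_x s t : 0 <= s <= h -> 0 <= t <= h ->
    ball x r (s *: u + (t *: v + x)).
  move=> /andP[s0 sh] /andP[t0 th]; rewrite -ball_normE /= distrC addrA addrK.
  rewrite (le_lt_trans (ler_normD _ _)) // !normrZ !ger0_norm //.
  apply: (@le_lt_trans _ _ (h * (1 + `|u| + `|v|))).
    have := ler_wpM2r (normr_ge0 u) sh; have := ler_wpM2r (normr_ge0 v) th.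
    by move: h0; rewrite !mulrDr mulr1; lra.
  rewrite /h mulrAC divfK ?gt_eqF // ltr_pdivrMr // ltr_pMr // ltr1n //.
have dFuv s t : 0 <= s <= h -> 0 <= t <= h ->
    derivable F (s *: u + (t *: v + x)) u /\
    derivable ('D_u F) (t *: v + (s *: u + x)) v.
  move=> sh th; have [[du _ dvu _] _] := rP _ (near_x _ _ sh th).
  by split; [exact: du | rewrite addrCA; exact: dvu].
have dFvu s t : 0 <= s <= h -> 0 <= t <= h ->
    derivable F (s *: v + (t *: u + x)) v /\
    derivable ('D_v F) (t *: u + (s *: v + x)) u.
  move=> sh th; have [[_ dv _ duv] _] := rP _ (near_x _ _ th sh).
  by split; [rewrite addrCA; exact: dv | exact: duv].
have [s [t [sh th E1]]] := second_difference_mvt h0 dFuv.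
have [t' [s' [th' sh' E2]]] := second_difference_mvt h0 dFvu.
have E : 'D_v ('D_u F) (s *: u + (t *: v + x))
       = 'D_u ('D_v F) (s' *: u + (t' *: v + x)).
  have hh : h * h != 0 by rewrite mulf_neq0 // gt_eqF.
  (* The two second differences agree up to the order of their terms. *)
  apply: (mulfI hh); rewrite -[LHS]E1 [s' *: u + _]addrCA -[RHS]E2.
  by rewrite [h *: v + (h *: u + x)]addrCA; ring.
have [_ [B1 _]] := rP _ (near_x _ _ sh th).
have [_ [_ B2]] := rP _ (near_x _ _ sh' th').
rewrite E in B1; rewrite distrC in B2.
by rewrite (splitr e) (le_trans (ler_distD _ _ _) (lerD (ltW B1) (ltW _))) //.
Qed.

End Schwarz.

(** * Calculus of smooth functions in one chart *)

Section ChartCalculus.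
Context {R : realType} {m : nat} {M : chartedSpace R m}.
Implicit Types (a : chart M) (p q : M) (f h : M -> R).

Definition eq_on_chart a f h := forall p, dom a p -> f p = h p.

Lemma near_chart_inv a p : dom a p ->
  \forall x \near chart_map a p, dom a (chart_inv a x) /\
    chart_map a (chart_inv a x) = x.
Proof.
move=> ap; have : nbhs (chart_map a p) (chart_map a @` dom a).
  by apply: open_nbhs_nbhs; split; [exact: image_open | exists p].
by apply: filterS => _ [q aq <-]; rewrite chart_mapK.
Qed.

Definition regular_at a f p :=
  {for p, continuous f} /\
  forall i, derivable (f \o chart_inv a) (chart_map a p) (delta_mx 0 i).

Lemma eq_on_chart_near a f h p : eq_on_chart a f h -> dom a p ->
  \forall x \near chart_map a p, (f \o chart_inv a) x = (h \o chart_inv a) x.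
Proof.
by move=> fh /near_chart_inv; apply: filterS => x [ax _]; rewrite /= fh.
Qed.

Lemma eq_pd a i f h : eq_on_chart a f h -> eq_on_chart a (pd a i f) (pd a i h).
Proof.
by move=> fh p ap; apply: near_eq_derive; exact: eq_on_chart_near fh ap.
Qed.

Lemma eq_regular_at a f h p : eq_on_chart a f h -> dom a p ->
  regular_at a h p -> regular_at a f p.
Proof.
move=> fh ap [ch dh]; split; last first.
  move=> i; apply: near_eq_derivable (dh i).
  by apply: eq_on_chart_near ap => q /fh.
have fhp : \forall q \near p, h q = f q.
  have : nbhs p (dom a) by apply: open_nbhs_nbhs; split; [exact: dom_open |].
  by apply: filterS => q /fh.
have -> : {for p, continuous f} = (f x @[x --> p] --> h p) by rewrite -fh.
by apply: cvg_trans ch; exact: near_eq_cvg.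
Qed.

Lemma iter_pd_rcons a s i f : iter_pd a (rcons s i) f = iter_pd a s (pd a i f).
Proof. by rewrite /iter_pd foldr_rcons. Qed.

Lemma smooth_regular a f p : chart_smooth a (dom a) f -> dom a p ->
  regular_at a f p.
Proof. by move=> sf ap; exact: (sf [::] p ap ap). Qed.

Lemma smooth_pd a i f : chart_smooth a (dom a) f ->
  chart_smooth a (dom a) (pd a i f).
Proof. by move=> sf s p; rewrite -iter_pd_rcons; exact: sf. Qed.

(** Coinduction for smoothness: a class of regular functions that is stable
    under coordinate derivatives, up to equality on the chart domain, consists
    of smooth functions. Equality on the domain only is the right notion,
    because the derivatives of a function at a point outside of it are
    meaningless. *)
Lemma smooth_coind a (P : (M -> R) -> Prop) :
  (forall f, P f -> forall p, dom a p -> regular_at a f p) ->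
  (forall f i, P f -> exists2 h, P h & eq_on_chart a (pd a i f) h) ->
  forall f h, P h -> eq_on_chart a f h -> chart_smooth a (dom a) f.
Proof.
move=> P_reg P_pd f h Ph fh s p _ ap; move: s f h Ph fh.
elim/last_ind => [|s i IH] f h Ph fh.
  exact: eq_regular_at fh ap (P_reg _ Ph _ ap).
have [h' Ph' hh'] := P_pd h i Ph.
rewrite iter_pd_rcons; apply: (IH _ h') => // q aq.
by rewrite (eq_pd i fh) // hh'.
Qed.

Section Rules.
Context (a : chart M) (p : M) (ap : dom a p) (f h : M -> R).
Context (rf : regular_at a f p) (rh : regular_at a h p).

Lemma pdD i : pd a i (f + h) p = pd a i f p + pd a i h p.
Proof. by apply: deriveD; [case: rf | case: rh]. Qed.

Lemma pdM i : pd a i (f * h) p = pd a i f p * h p + f p * pd a i h p.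
Proof.
rewrite /pd [_ \o _](_ : _ = (f \o chart_inv a) * (h \o chart_inv a)) //.
rewrite deriveM; [|by case: rf|by case: rh].
by rewrite /= chart_mapK // addrC [_ *: _]mulrC.
Qed.

Lemma regularD : regular_at a (f + h) p.
Proof.
case: rf rh => cf df [ch dh]; split; first exact: continuousD.
by move=> i; apply: derivableD.
Qed.

Lemma regularM : regular_at a (f * h) p.
Proof.
case: rf rh => cf df [ch dh]; split; first exact: continuousM.
by move=> i; apply: derivableM.
Qed.

End Rules.

Lemma regular_cst a p (c : R) : regular_at a (cst c) p.
Proof.
split=> [|i]; first exact: cst_continuous.
exact: derivable_cst.
Qed.

Lemma pd_cst a i (c : R) p : pd a i (cst c) p = 0.
Proof. exact: derive_cst. Qed.

(** The closure of the smooth functions under the ring operations. It is stable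
    under coordinate derivatives by the Leibniz rule, hence by [smooth_coind] it
    contains smooth functions only; this treats all orders of differentiation
    and all polynomial expressions at once. *)
Inductive smooth_poly a : (M -> R) -> Prop :=
| SmoothPolyGen f of chart_smooth a (dom a) f : smooth_poly a f
| SmoothPolyCst c : smooth_poly a (cst c)
| SmoothPolyAdd f h of smooth_poly a f & smooth_poly a h :
    smooth_poly a (f + h)
| SmoothPolyMul f h of smooth_poly a f & smooth_poly a h :
    smooth_poly a (f * h).

Lemma smooth_poly_regular a f : smooth_poly a f ->
  forall p, dom a p -> regular_at a f p.
Proof.
move=> + p ap; elim=> {f} [f sf|c|f h _ rf _ rh|f h _ rf _ rh].
- exact: smooth_regular.
- exact: regular_cst.
- exact: regularD.
- exact: regularM.
Qed.

Lemma smooth_polyP a f h : smooth_poly a h -> eq_on_chart a f h ->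
  chart_smooth a (dom a) f.
Proof.
apply: smooth_coind => {f h} [|f i]; first exact: smooth_poly_regular.
elim=> {f} [f sf|c|f h sf [f' sf' ff'] sh [h' sh' hh']|
            f h sf [f' sf' ff'] sh [h' sh' hh']].
- by exists (pd a i f) => //; apply: SmoothPolyGen; exact: smooth_pd.
- by exists (cst 0); [exact: SmoothPolyCst | move=> p _; exact: pd_cst].
- exists (f' + h'); first exact: SmoothPolyAdd.
  move=> p ap; rewrite pdD ?ff' ?hh' //; exact: smooth_poly_regular ap.
- exists (f' * h + f * h').
    by apply: SmoothPolyAdd; exact: SmoothPolyMul.
  move=> p ap; rewrite pdM ?ff' ?hh' //; exact: smooth_poly_regular ap.
Qed.

(** On the open image of the chart the two sides are the mixed derivatives of
    [f] read in coordinates. This holds near the point, and not merely at it, so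
    that [schwarz] applies. *)
Lemma pdC a f i j : chart_smooth a (dom a) f ->
  eq_on_chart a (pd a i (pd a j f)) (pd a j (pd a i f)).
Proof.
move=> sf p ap; pose x := chart_map a p; pose F := f \o chart_inv a.
pose e (k : 'I_m) : 'rV[R]_m := delta_mx 0 k.
have pdE k : \forall y \near x, (pd a k f \o chart_inv a) y = 'D_(e k) F y.
  by apply: filterS (near_chart_inv ap) => y [_ yK]; rewrite /= /pd yK.
have pd2E k l : \forall y \near x,
    (pd a l (pd a k f) \o chart_inv a) y = 'D_(e l) ('D_(e k) F) y.
  have Ux : \forall y \near x, \forall z \near y,
    (pd a k f \o chart_inv a) z = 'D_(e k) F z by exact: near_join.
  near=> y; have [_ yK] : dom a (chart_inv a y) /\
      chart_map a (chart_inv a y) = y by near: y; exact: near_chart_inv.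
  by rewrite /= /pd yK; apply: near_eq_derive; near: y.
have xE k l : 'D_(e l) ('D_(e k) F) x = pd a l (pd a k f) p.
  by rewrite -(nbhs_singleton (pd2E k l)) /= chart_mapK.
have dF k l : \forall y \near x,
    derivable F y (e k) /\ derivable ('D_(e k) F) y (e l).
  have Ux : \forall y \near x, \forall z \near y,
    (pd a k f \o chart_inv a) z = 'D_(e k) F z by exact: near_join.
  near=> y; have [ay yK] : dom a (chart_inv a y) /\
      chart_map a (chart_inv a y) = y by near: y; exact: near_chart_inv.
  rewrite -[y in derivable F y]yK.
  split; first by case: (smooth_regular sf ay).
  have := (smooth_regular (smooth_pd k sf) ay).2 l; rewrite yK.
  by apply: near_eq_derivable; near: y.
have cF k l : {for x, continuous ('D_(e l) ('D_(e k) F))}.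
  have -> : {for x, continuous ('D_(e l) ('D_(e k) F))}
    = ('D_(e l) ('D_(e k) F) y @[y --> x] --> pd a l (pd a k f) p).
    by rewrite -xE.
  apply: (@cvg_trans _ ((pd a l (pd a k f) \o chart_inv a) @ x)).
    exact: (near_eq_cvg (pd2E k l)).
  have c1 : chart_inv a y @[y --> x] --> p.
    have -> : p = chart_inv a x by rewrite chart_mapK.
    by apply: chart_inv_continuous; exists p.
  have c2 := (smooth_regular (smooth_pd l (smooth_pd k sf)) ap).1.
  exact: (cvg_comp _ _ c1 c2).
rewrite -!xE; apply: schwarz; [|exact: cF|exact: cF].
by apply: filterS2 (dF j i) (dF i j) => y [d1 d2] [d3 d4]; split.
Unshelve. all: by end_near. Qed.

End ChartCalculus.

(** * The ring of smooth functions on a chart domain *)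

Section SmoothRing.
Context {R : realType} {m : nat} {M : chartedSpace R m} {a : chart M}.
Implicit Types (p : M).

(** Coordinate derivatives are defined for total functions; on the domain, which
    is open, they are determined by the values there. *)
Definition extend (F : {p | dom a p} -> R) : M -> R := fun p =>
  if pselect (dom a p) is left ap then F (exist _ p ap) else 0.

Lemma extendE F p (ap : dom a p) : extend F p = F (exist _ p ap).
Proof.
by rewrite /extend; case: pselect => // ap'; congr (F (exist _ _ _)).
Qed.

Definition smooth_pred : {pred {p | dom a p} -> R} :=
  fun F => `[< chart_smooth a (dom a) (extend F) >].

Lemma smooth_predP F : reflect (chart_smooth a (dom a) (extend F))
  (F \in smooth_pred).
Proof. exact: asboolP. Qed.

Lemma smooth_pred_subring : subring_closed smooth_pred.
Proof.
split=> [|F H /smooth_predP sF /smooth_predP sH|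
         F H /smooth_predP sF /smooth_predP sH]; apply/smooth_predP.
- by apply: smooth_polyP (SmoothPolyCst a 1) _ => p ap; rewrite extendE.
- apply: (@smooth_polyP _ _ _ _ _ (extend F + cst (-1) * extend H)).
    apply: SmoothPolyAdd; first exact: SmoothPolyGen.
    by apply: SmoothPolyMul; [exact: SmoothPolyCst | exact: SmoothPolyGen].
  by move=> p ap; rewrite !fctE !(extendE _ ap) mulN1r.
- apply: (@smooth_polyP _ _ _ _ _ (extend F * extend H)).
    by apply: SmoothPolyMul; exact: SmoothPolyGen.
  by move=> p ap; rewrite !fctE !(extendE _ ap).
Qed.

HB.instance Definition _ := GRing.isSubringClosed.Build _ smooth_pred
  smooth_pred_subring.

(** Functions on the subtype of the points of the domain, so that two elements
    of the ring are equal as soon as they agree on the domain. *)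
Record smooth_fun := SmoothFun {
  smooth_val :> {p | dom a p} -> R;
  smooth_valP : smooth_val \in smooth_pred }.

HB.instance Definition _ := [isSub for smooth_val].
HB.instance Definition _ := [Choice of smooth_fun by <:].
HB.instance Definition _ :=
  GRing.SubChoice_isSubComPzRing.Build _ _ smooth_fun smooth_pred_subring.

Implicit Types F H : smooth_fun.

Definition value p (ap : dom a p) (F : smooth_fun) : R := F (exist _ p ap).

Lemma value_is_zmod_morphism p (ap : dom a p) : zmod_morphism (value ap).
Proof. by []. Qed.
Lemma value_is_monoid_morphism p (ap : dom a p) : monoid_morphism (value ap).
Proof. by []. Qed.
HB.instance Definition _ p (ap : dom a p) :=
  GRing.isZmodMorphism.Build smooth_fun R (value ap)
    (value_is_zmod_morphism ap).
HB.instance Definition _ p (ap : dom a p) :=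
  GRing.isMonoidMorphism.Build smooth_fun R (value ap)
    (value_is_monoid_morphism ap).

#[local] Arguments value : simpl never.

Lemma value_inj (F H : smooth_fun) :
  (forall p (ap : dom a p), value ap F = value ap H) -> F = H.
Proof. by move=> FH; apply/val_inj/funext => -[p ap]; exact: FH. Qed.

Lemma smooth_extend (F : smooth_fun) : chart_smooth a (dom a) (extend F).
Proof. by apply/smooth_predP; exact: smooth_valP. Qed.

Fact restrict_smooth (f : M -> R) : chart_smooth a (dom a) f ->
  (fun x : {p | dom a p} => f (sval x)) \in smooth_pred.
Proof.
move=> sf; apply/smooth_predP; apply: smooth_polyP (SmoothPolyGen sf) _.
by move=> p ap; rewrite extendE.
Qed.

Definition restrict_to_chart f (sf : chart_smooth a (dom a) f) : smooth_fun :=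
  SmoothFun (restrict_smooth sf).

Definition chart_deriv (i : 'I_m) (F : smooth_fun) : smooth_fun :=
  restrict_to_chart (smooth_pd i (smooth_extend F)).

Lemma value_chart_deriv p (ap : dom a p) i F :
  value ap (chart_deriv i F) = pd a i (extend F) p.
Proof. by []. Qed.

Lemma extend_regular (F : smooth_fun) p : dom a p -> regular_at a (extend F) p.
Proof. exact: smooth_regular (smooth_extend F). Qed.

Lemma chart_derivD i F H :
  chart_deriv i (F + H) = chart_deriv i F + chart_deriv i H.
Proof.
apply: value_inj => p ap; rewrite rmorphD /= !value_chart_deriv.
rewrite -pdD; [|exact: extend_regular..].
by apply: eq_pd => // q aq; rewrite fctE !(extendE _ aq).
Qed.

Lemma chart_derivM i F H :
  chart_deriv i (F * H) = chart_deriv i F * H + F * chart_deriv i H.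
Proof.
apply: value_inj => p ap; rewrite rmorphD !rmorphM /= !value_chart_deriv.
rewrite {1 2}/value -!(extendE _ ap) -(pdM ap).
2,3: exact: extend_regular.
by apply: eq_pd => // q aq; rewrite fctE !(extendE _ aq).
Qed.

Lemma chart_derivC i j F :
  chart_deriv i (chart_deriv j F) = chart_deriv j (chart_deriv i F).
Proof.
apply: value_inj => p ap; rewrite !value_chart_deriv.
have E k l : pd a k (extend (chart_deriv l F)) p = pd a k (pd a l (extend F)) p.
  by apply: eq_pd => // q aq; rewrite extendE.
by rewrite !E; apply: pdC => //; exact: smooth_extend.
Qed.

Lemma smooth_fun_double_inj (F : smooth_fun) : F + F = 0 -> F = 0.
Proof.
move=> FF; apply: value_inj => p ap; have := congr1 (value ap) FF.
by rewrite rmorphD rmorph0 /= -mulr2n => /eqP; rewrite mulrn_eq0 => /eqP.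
Qed.

End SmoothRing.
Arguments smooth_fun {R m M} a.
#[global] Arguments value : simpl never.

(** * Tensor fields with coefficients in that ring *)

Section Represents.
Context {R : realType} {m : nat} {M : manifold R m} {a : chart M}.
Local Notation A := (smooth_fun a).

Definition represents (f : M -> R) (F : A) :=
  forall p (ap : dom a p), f p = value ap F.

Definition represents_mx k l (T : M -> 'M[R]_(k, l)) (X : 'M[A]_(k, l)) :=
  forall p (ap : dom a p), T p = map_mx (value ap) X.

Definition extend_mx k l (X : 'M[A]_(k, l)) : M -> 'M[R]_(k, l) :=
  fun p => \matrix_(i, j) extend (X i j) p.

Lemma extend_mxP k l (X : 'M[A]_(k, l)) : represents_mx (extend_mx X) X.
Proof. by move=> p ap; apply/matrixP => i j; rewrite !mxE extendE. Qed.

Lemma extend_mx_local (X : 'rV[A]_m) : local_field a (dom a) (extend_mx X).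
Proof.
move=> k; rewrite [X in chart_smooth _ _ X](_ : _ = extend (X 0 k)).
  exact: smooth_extend.
by apply/funext => p; rewrite mxE.
Qed.

Lemma value_mx_inj k l (X Y : 'M[A]_(k, l)) :
  (forall p (ap : dom a p), map_mx (value ap) X = map_mx (value ap) Y) -> X = Y.
Proof.
move=> XY; apply/matrixP => i j; apply: value_inj => p ap.
by have /matrixP/(_ i j) := XY p ap; rewrite !mxE.
Qed.

Lemma represents_entry k l (T : M -> 'M[R]_(k, l)) X i j :
  represents_mx T X -> represents (fun p => T p i j) (X i j).
Proof. by move=> TX p ap; rewrite (TX p ap) mxE. Qed.

Lemma represents_pd i f F :
  represents f F -> represents (pd a i f) (chart_deriv i F).
Proof.
move=> fF p ap; rewrite value_chart_deriv; apply: eq_pd => // q aq.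
by rewrite extendE; exact: fF.
Qed.

Lemma represents_along (X' : M -> 'rV[R]_m) X f F :
  represents_mx X' X -> represents f F ->
  represents (along a X' f) (coord_lie chart_deriv X F).
Proof.
move=> XX fF p ap; rewrite /along /coord_lie rmorph_sum; apply: eq_bigr => i _.
by rewrite rmorphM (represents_entry 0 i XX ap) (represents_pd i fF ap).
Qed.

Context (D : affine_connection M).

Definition symbol_fun (i j : 'I_m) : 'rV[A]_m :=
  \row_k restrict_to_chart (@symbol_smooth _ _ _ D a i j k).

Local Notation lieA := (coord_lie chart_deriv).
Local Notation nabA := (coord_nabla chart_deriv symbol_fun).

Lemma represents_nabla (X' Y' : M -> 'rV[R]_m) X Y :
  represents_mx X' X -> represents_mx Y' Y ->
  represents_mx (nabla D a X' Y') (nabA X Y).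
Proof.
move=> XX YY p ap; apply/rowP => k; rewrite !mxE rmorphD; congr (_ + _).
  by rewrite (represents_along XX (represents_entry 0 k YY) ap).
rewrite !summxE rmorph_sum; apply: eq_bigr => i _.
rewrite !summxE rmorph_sum; apply: eq_bigr => j _.
rewrite !mxE !rmorphM.
by rewrite (represents_entry 0 i XX ap) (represents_entry 0 j YY ap).
Qed.

Lemma represents_bracket (X' Y' : M -> 'rV[R]_m) X Y :
  represents_mx X' X -> represents_mx Y' Y ->
  represents_mx (bracket a X' Y') (coord_bracket chart_deriv X Y).
Proof.
move=> XX YY p ap; apply/rowP => k; rewrite !mxE rmorphB.
by rewrite (represents_along XX (represents_entry 0 k YY) ap)
  (represents_along YY (represents_entry 0 k XX) ap).
Qed.

Lemma represents_frame i : represents_mx (frame i) (delta_mx 0 i).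
Proof. by move=> p ap; rewrite map_delta_mx. Qed.

Context (torsion : torsion_free D).

Lemma smooth_torsion X Y : nabA X Y - nabA Y X = coord_bracket chart_deriv X Y.
Proof.
apply: value_mx_inj => p ap.
rewrite map_mxB -!(represents_nabla (extend_mxP _) (extend_mxP _)).
rewrite -(represents_bracket (extend_mxP _) (extend_mxP _)).
by apply: torsion => //; exact: extend_mx_local.
Qed.

Lemma smooth_connection : torsion_free_connection lieA nabA.
Proof.
exact: (coord_connection chart_derivD chart_derivM chart_derivC smooth_torsion).
Qed.

Lemma represents_curvature (X' Y' Z' : M -> 'rV[R]_m) X Y Z :
  represents_mx X' X -> represents_mx Y' Y -> represents_mx Z' Z ->
  represents_mx (curvature D a X' Y' Z') (curv nabA X Y Z).
Proof.
move=> XX YY ZZ p ap; rewrite /curv !map_mxB smooth_torsion /curvature.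
rewrite (represents_nabla XX (represents_nabla YY ZZ) ap).
rewrite (represents_nabla YY (represents_nabla XX ZZ) ap).
by rewrite (represents_nabla (represents_bracket XX YY) ZZ ap).
Qed.

Lemma represents_ricci i j :
  represents (fun p => ricci D a p i j)
    (ric nabA (delta_mx 0 i) (delta_mx 0 j)).
Proof.
move=> p ap; rewrite mxE rmorph_sum; apply: eq_bigr => k _.
have rC := represents_curvature (represents_frame k) (represents_frame i)
  (represents_frame j).
by rewrite (represents_entry 0 k rC ap).
Qed.

Lemma represents_hessian f F i j : represents f F ->
  represents (fun p => hessian D f a p i j)
    (hess lieA nabA F (delta_mx 0 i) (delta_mx 0 j)).
Proof.
move=> fF p ap; rewrite mxE /hess rmorphB.
have ei := represents_frame i; have ej := represents_frame j.
rewrite (represents_along ei (represents_along ej fF) ap).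
by rewrite (represents_along (represents_nabla ei ej) fF ap).
Qed.

End Represents.

(** * Contact metric algebra at one point *)

Section PointwiseContactMetric.
Context {R : realType} {m : nat}.
Context (phi g : 'M[R]_m) (xi : 'rV[R]_m) (eta : 'cV[R]_m).
Context (phi2 : forall u : 'rV[R]_m, u *m phi *m phi = - u + ev1 eta u *: xi).
Context (eta_xi : ev1 eta xi = 1).
Context (compat : forall u v : 'rV[R]_m,
  ev2 g (u *m phi) (v *m phi) = ev2 g u v - ev1 eta u * ev1 eta v).
Context (g_pos : forall u, u != 0 -> 0 < ev2 g u u).

Lemma ev1Z c u : ev1 eta (c *: u) = c * ev1 eta u.
Proof. by rewrite /ev1 -scalemxAl mxE. Qed.

Lemma ev1_0 : ev1 eta 0 = 0.
Proof. by rewrite /ev1 mul0mx mxE. Qed.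

(** As [phi] kills [phi xi], the equation for [phi^2] makes [phi xi] a multiple
    [c xi] of [xi]; then [c^2 xi = phi (phi xi) = 0]. *)
Lemma reeb_phi : xi *m phi = 0.
Proof.
pose c := ev1 eta (xi *m phi).
have xi2 : xi *m phi *m phi = 0.
  by rewrite phi2 eta_xi scale1r addNr.
have xi1 : xi *m phi = c *: xi.
  have := phi2 (xi *m phi); rewrite xi2 mul0mx => /esym/eqP.
  by rewrite addrC subr_eq0 => /eqP.
have : c ^+ 2 = 0.
  have := congr1 (ev1 eta) xi2.
  by rewrite xi1 -scalemxAl xi1 !ev1Z eta_xi ev1_0 mulr1.
by move/eqP; rewrite sqrf_eq0 => /eqP c0; rewrite xi1 c0 scale0r.
Qed.

(** Both bracketings of [phi^3] are compared. *)
Lemma ev1_phi u : ev1 eta (u *m phi) = 0.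
Proof.
have := phi2 (u *m phi); rewrite (phi2 u) mulmxDl mulNmx -scalemxAl reeb_phi.
rewrite scaler0 => /addrI/esym/(congr1 (ev1 eta)).
by rewrite ev1Z eta_xi ev1_0 mulr1.
Qed.

Lemma ev2_reeb u : ev2 g u xi = ev1 eta u.
Proof.
have := compat u xi; rewrite reeb_phi {1}/ev2 trmx0 mulmx0 mxE eta_xi mulr1.
by move/esym/eqP; rewrite subr_eq0 => /eqP.
Qed.

Lemma metric_reeb : g *m xi^T = eta.
Proof.
apply/colP => i; have := ev2_reeb (delta_mx 0 i).
by rewrite /ev2 /ev1 -mulmxA -!rowE !mxE.
Qed.

Lemma metric_unit : g \in unitmx.
Proof.
rewrite -row_free_unit -kermx_eq0; apply/negPn/negP.
case/rowV0Pn => u /sub_kermxP ug u0; have := g_pos u0.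
by rewrite /ev2 ug mul0mx mxE ltxx.
Qed.

(** The trace of [eta (x) eta] with respect to [g] is [eta(xi) = 1], since [eta]
    is the metric dual of [xi]. *)
Lemma trace_eta_einstein (c b : R) :
  \tr (invmx g *m (c *: g + b *: (eta *m eta^T))) = c * m%:R + b.
Proof.
rewrite mulmxDr -!scalemxAr mulVmx ?metric_unit // mxtraceD !mxtraceZ mxtrace1.
congr (_ + _); rewrite mulmxA mxtrace_mulC -{2}metric_reeb.
rewrite mulKmx ?metric_unit //.
rewrite -trmx_mul mxtrace_tr trace_mx11 -/(ev1 eta xi) eta_xi.
by rewrite mulr1.
Qed.

End PointwiseContactMetric.

(** * Kenmotsu solitons in one chart *)

Section KenmotsuChart.
Context {R : realType} {m : nat} {M : manifold R m}.
Context (phi : chart M -> M -> 'M[R]_m) (xi : chart M -> M -> 'rV[R]_m).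
Context (eta : chart M -> M -> 'cV[R]_m) (g : chart M -> M -> 'M[R]_m).
Context (D : affine_connection M) (hM : kenmotsu D phi xi eta g).
Context (a : chart M).
Local Notation A := (smooth_fun a).
Local Notation lieA := (coord_lie (@chart_deriv _ _ _ a)).
Local Notation nabA := (coord_nabla chart_deriv (@symbol_fun _ _ _ a D)).

Definition smooth_mx k l (T : chart M -> M -> 'M[R]_(k, l))
    (sT : smooth_comp T) : 'M[A]_(k, l) :=
  \matrix_(i, j) restrict_to_chart (sT a i j).

Lemma smooth_mxP k l (T : chart M -> M -> 'M[R]_(k, l)) (sT : smooth_comp T) :
  represents_mx (T a) (smooth_mx sT).
Proof. by move=> p ap; apply/matrixP => i j; rewrite !mxE. Qed.

Lemma phi_smooth : smooth_comp phi. Proof. by case: hM => -[[[]]]. Qed.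
Lemma xi_smooth : smooth_comp xi. Proof. by case: hM => -[[_ []]]. Qed.
Lemma g_smooth : smooth_comp g. Proof. by case: hM => -[_ [[]]]. Qed.

Let phiA := smooth_mx phi_smooth.
Let xiA := smooth_mx xi_smooth.
Let gA := smooth_mx g_smooth.

Definition smooth_metric (X Y : 'rV[A]_m) : A := (X *m gA *m Y^T) 0 0.
Local Notation gf := smooth_metric.

Lemma represents_metric (X' Y' : M -> 'rV[R]_m) X Y :
  represents_mx X' X -> represents_mx Y' Y ->
  represents (fun q => ev2 (g a q) (X' q) (Y' q)) (gf X Y).
Proof.
move=> XX YY p ap; rewrite XX YY (smooth_mxP g_smooth ap) /ev2.
by rewrite map_trmx -!map_mxM mxE.
Qed.

Lemma value_metric p (ap : dom a p) X Y :
  value ap (gf X Y) = ev2 (g a p) (map_mx (value ap) X) (map_mx (value ap) Y).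
Proof.
by rewrite -(represents_metric (extend_mxP X) (extend_mxP Y)) !extend_mxP.
Qed.

Let contact p (ap : dom a p) :
  (forall u : 'rV[R]_m,
     u *m phi a p *m phi a p = - u + ev1 (eta a p) u *: xi a p) /\
  ev1 (eta a p) (xi a p) = 1.
Proof. by case: hM => -[[_ _ _ /(_ a p ap)]]. Qed.

Let phi2 p (ap : dom a p) := (contact ap).1.
Let eta_xi p (ap : dom a p) := (contact ap).2.

Let compat p (ap : dom a p) (u v : 'rV[R]_m) :
  ev2 (g a p) (u *m phi a p) (v *m phi a p) =
    ev2 (g a p) u v - ev1 (eta a p) u * ev1 (eta a p) v.
Proof. by case: hM => -[_ _ /(_ a p ap)]. Qed.

Let metricC p (ap : dom a p) u v : ev2 (g a p) u v = ev2 (g a p) v u.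
Proof. by case: hM => -[_ [_ /(_ a p ap)[]]]. Qed.

Let metric_pos p (ap : dom a p) u : u != 0 -> 0 < ev2 (g a p) u u.
Proof. by have [[_ [_ H] _] _ _] := hM; exact: (H a p ap).2. Qed.

Lemma value_eta p (ap : dom a p) X :
  value ap (gf X xiA) = ev1 (eta a p) (map_mx (value ap) X).
Proof.
rewrite value_metric -(smooth_mxP xi_smooth).
exact: (ev2_reeb (phi2 ap) (eta_xi ap) (compat ap)).
Qed.

Lemma kenmotsu_connection : torsion_free_connection lieA nabA.
Proof. by apply: smooth_connection; case: hM => _ []. Qed.

Lemma smooth_metricC X Y : gf X Y = gf Y X.
Proof. by apply: value_inj => p ap; rewrite !value_metric metricC. Qed.

Lemma smooth_metricD X Y Z : gf (X + Y) Z = gf X Z + gf Y Z.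
Proof. by rewrite /gf !mulmxDl mxE. Qed.

Lemma smooth_metricZ c X Y : gf (c *: X) Y = c * gf X Y.
Proof. by rewrite /gf -!scalemxAl mxE. Qed.

Lemma smooth_metric_parallel X Y Z :
  lieA X (gf Y Z) = gf (nabA X Y) Z + gf Y (nabA X Z).
Proof.
have [_ [_ metric] _] := hM.
apply: value_inj => p ap; rewrite rmorphD /=.
have XX := extend_mxP X; have YY := extend_mxP Y; have ZZ := extend_mxP Z.
rewrite -(represents_along XX (represents_metric YY ZZ) ap).
rewrite -(represents_metric (represents_nabla D XX YY) ZZ ap).
rewrite -(represents_metric YY (represents_nabla D XX ZZ) ap).
by apply: metric => //; exact: extend_mx_local.
Qed.

(** Positivity is used with the difference [X - Y] itself as test field. *)
Lemma smooth_metric_nondeg X Y : (forall W, gf X W = gf Y W) -> X = Y.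
Proof.
move=> XY; apply/eqP; rewrite -subr_eq0; apply/eqP/value_mx_inj => p ap.
rewrite map_mx0; apply/eqP/negPn/negP => /(metric_pos ap).
rewrite -value_metric smooth_metricD -scaleN1r smooth_metricZ XY mulN1r subrr.
by rewrite rmorph0 ltxx.
Qed.

Lemma smooth_reeb_unit : gf xiA xiA = 1.
Proof.
apply: value_inj => p ap; rewrite value_eta -(smooth_mxP xi_smooth).
by rewrite eta_xi ?rmorph1.
Qed.

Lemma smooth_nabla_reeb X : nabA X xiA = X - gf X xiA *: xiA.
Proof.
have xiP := smooth_mxP xi_smooth; have phiP := smooth_mxP phi_smooth.
apply: (nab_reeb kenmotsu_connection smooth_metricC smooth_metric_parallel
  (@smooth_fun_double_inj _ _ _ _) smooth_reeb_unit
  (phi := fun Y => Y *m phiA)) => {X}.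
- by move=> X Y; rewrite mulmxDl.
- by move=> c X; rewrite -scalemxAl.
- move=> X; apply: value_mx_inj => p ap.
  rewrite map_mxD map_mxN map_mxZ !map_mxM -phiP -xiP /= value_eta.
  exact: phi2.
- apply: value_mx_inj => p ap; rewrite map_mxM -phiP -xiP map_mx0.
  exact: reeb_phi (phi2 ap) (eta_xi ap).
- move=> X; apply: value_inj => p ap; rewrite value_eta map_mxM -phiP rmorph0.
  exact: ev1_phi (phi2 ap) (eta_xi ap) _.
- move=> X; apply: value_mx_inj => p ap.
  have XX := extend_mxP X; have [_ _ ken] := hM.
  have rphi (Y' : M -> 'rV[R]_m) Y : represents_mx Y' Y ->
      represents_mx (fun q => Y' q *m phi a q) (Y *m phiA).
    by move=> YY q aq; rewrite map_mxM -phiP YY.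
  rewrite !map_mxB map_mxM !map_mxZ -phiP -xiP /=.
  rewrite !value_metric map_mxM -phiP -xiP.
  rewrite -(represents_nabla D XX (rphi _ _ xiP) ap).
  rewrite -(represents_nabla D XX xiP ap).
  rewrite -XX (ev2_reeb (phi2 ap) (eta_xi ap) (compat ap) (xi a p)).
  apply: ken => //; first exact: extend_mx_local.
  by move=> k; exact: xi_smooth.
Qed.

Context (f lam mu : M -> R).
Context (hsol : gradient_almost_eta_ricci_soliton D g eta f lam mu).

Lemma f_smooth : smooth f. Proof. by case: hsol. Qed.
Lemma lam_smooth : smooth lam. Proof. by case: hsol. Qed.
Lemma mu_smooth : smooth mu. Proof. by case: hsol. Qed.

Let fA : A := restrict_to_chart (@f_smooth a).
Let lamA : A := restrict_to_chart (@lam_smooth a).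
Let muA : A := restrict_to_chart (@mu_smooth a).

Definition ricci_factor : A := soliton_factor lieA xiA fA lamA muA.

Let e k : 'rV[A]_m := delta_mx 0 k.

Lemma value_metric_frame p (ap : dom a p) i j :
  value ap (gf (e i) (e j)) = g a p i j.
Proof.
by rewrite value_metric !map_delta_mx /ev2 -rowE trmx_delta -colE !mxE.
Qed.

Lemma value_eta_frame p (ap : dom a p) i :
  value ap (gf (e i) xiA) = eta a p i 0.
Proof. by rewrite value_eta map_delta_mx /ev1 -rowE mxE. Qed.

Let torsion : torsion_free D. Proof. by case: hM => _ []. Qed.

Lemma smooth_soliton_frame i j :
  let e k : 'rV[A]_m := delta_mx 0 k in
  hess lieA nabA fA (e i) (e j) + ric nabA (e i) (e j) + lamA * gf (e i) (e j)
  + muA * (gf (e i) xiA * gf (e j) xiA) = 0.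
Proof.
move=> /=; apply: value_inj => p ap; rewrite 3!rmorphD !rmorphM rmorph0 /=.
rewrite value_metric_frame !value_eta_frame.
have fP : represents f fA by [].
rewrite -(represents_hessian D i j fP ap) -(represents_ricci torsion i j ap).
have [_ _ _ /(_ a p ap)/matrixP/(_ i j)] := hsol.
by rewrite !mxE big_ord1 !mxE.
Qed.

Lemma ricci_eta_einstein p (ap : dom a p) :
  ricci D a p = value ap ricci_factor *: g a p
  + (1 - m%:R - value ap ricci_factor) *: (eta a p *m (eta a p)^T).
Proof.
apply/matrixP => i j; rewrite [LHS](represents_ricci torsion i j ap).
rewrite (ric_soliton kenmotsu_connection smooth_metricC smooth_metricD
  smooth_metricZ smooth_metric_parallel (@smooth_fun_double_inj _ _ _ _)
  smooth_metric_nondeg smooth_reeb_unit smooth_nabla_reeb smooth_soliton_frame).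
rewrite !(rmorphB, rmorphD, rmorphM) rmorph1 rmorph_nat /=.
rewrite value_metric_frame !value_eta_frame !mxE big_ord1 !mxE /ricci_factor.
ring.
Qed.

Lemma ricci_of_factor_constant p (ap : dom a p) :
  value ap (lieA xiA ricci_factor) = 0 -> ricci D a p = - (m%:R - 1) *: g a p.
Proof.
move=> al0; apply/matrixP => i j.
rewrite [LHS](represents_ricci torsion i j ap).
have /(congr1 (value ap)) := lie_soliton_factor kenmotsu_connection
  smooth_metricC smooth_metricD
  smooth_metricZ smooth_metric_parallel (@smooth_fun_double_inj _ _ _ _)
  smooth_metric_nondeg smooth_reeb_unit smooth_nabla_reeb smooth_soliton_frame
  (e i) (e j).
rewrite -[soliton_factor _ _ _ _ _]/ricci_factor rmorphM /= al0 mul0r.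
rewrite rmorphM rmorphN rmorph_nat => /esym/eqP.
rewrite mulf_eq0 oppr_eq0 pnatr_eq0 /=.
rewrite rmorphD rmorphM rmorphB rmorph1 rmorph_nat /=.
by rewrite value_metric_frame addr_eq0 mxE mulNr => /eqP.
Qed.

Lemma scalar_curvature_factor p (ap : dom a p) :
  scalar_curvature g D a p = (m%:R - 1) * (value ap ricci_factor - 1).
Proof.
rewrite /scalar_curvature ricci_eta_einstein.
rewrite (trace_eta_einstein (phi2 ap) (eta_xi ap) (compat ap) (metric_pos ap)).
ring.
Qed.

(** The inverse matrix of the metric occurs in the scalar curvature, but does
    not have to be differentiated: on the chart domain the scalar curvature is
    an affine function of the smooth function [ricci_factor]. *)
Lemma along_scalar_curvature p (ap : dom a p) :
  along a (xi a) (scalar_curvature g D a) p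
  = (m%:R - 1) * value ap (lieA xiA ricci_factor).
Proof.
have rP : represents (scalar_curvature g D a) ((m%:R - 1) * (ricci_factor - 1)).
  by move=> q aq; rewrite scalar_curvature_factor !(rmorphM, rmorphB)
    rmorph_nat rmorph1.
rewrite (represents_along (smooth_mxP xi_smooth) rP ap).
have conn := kenmotsu_connection.
have c0 : lieA xiA (m%:R - 1) = 0.
  by rewrite (tfc_lieD conn) (lieN conn) (lie_nat conn) (lie1 conn) subrr.
rewrite (tfc_lieM conn) c0 mul0r add0r (tfc_lieD conn) (lieN conn) (lie1 conn).
by rewrite subr0 rmorphM rmorphB rmorph_nat rmorph1.
Qed.

End KenmotsuChart.

(** * The Einstein condition *)

Theorem theorem4p1 (R : realType) (n : nat) (M : manifold R (2 * n).+1)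
  (phi : chart M -> M -> 'M[R]_((2 * n).+1))
  (xi : chart M -> M -> 'rV[R]_((2 * n).+1))
  (eta : chart M -> M -> 'cV[R]_((2 * n).+1))
  (g : chart M -> M -> 'M[R]_((2 * n).+1))
  (D : affine_connection M)
  (hM : kenmotsu D phi xi eta g)
  (f lam mu : M -> R)
  (hsol : gradient_almost_eta_ricci_soliton D g eta f lam mu)
  (hr : forall (a : chart M) (p : M), dom a p ->
     along a (xi a) (scalar_curvature g D a) p = 0) :
  einstein D g /\
  (forall (a : chart M) (p : M), dom a p ->
     scalar_curvature g D a p = - (2 * n * (2 * n + 1))%N%:R).
Proof.
have ricE a p (ap : dom a p) : ricci D a p = - (2 * n)%:R *: g a p.
  (* In dimension one the curvature vanishes because it is alternating; for
     positive n the hypothesis on r makes the Ricci factor constant along xi. *)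
  have [n0|n_gt0] := posnP n.
    apply/matrixP => i j; case: (hM) => _ [torsion _] _.
    rewrite (represents_ricci torsion i j ap).
    have -> : (2 * n)%:R = 0 :> R by rewrite n0.
    rewrite oppr0 scale0r mxE /ric /trace big1 ?rmorph0 //.
    move=> k _; have -> : k = i.
      by apply: val_inj; case: k i => [[|k] kn] [[|i] im] //=;
        move: kn im; rewrite n0.
    rewrite (curvXX (kenmotsu_connection hM a)) ?mxE //.
    exact: smooth_fun_double_inj.
  have := ricci_of_factor_constant (hM := hM) (hsol := hsol) (ap := ap).
  rewrite -natr1 addrK; apply.
  have := along_scalar_curvature hM hsol ap.
  rewrite hr // -natr1 addrK => /esym/eqP.
  by rewrite mulf_eq0 pnatr_eq0 muln_eq0 /= (gtn_eqF n_gt0) => /eqP.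
split=> [|a p ap]; first by exists (- (2 * n)%:R).
have [[[_ _ _ contact] [_ metric] compat] _ _] := hM.
have [phi2 eta_xi] := contact a p ap; have [_ pos] := metric a p ap.
rewrite /scalar_curvature.
have -> : ricci D a p
    = - (2 * n)%:R *: g a p + 0 *: (eta a p *m (eta a p)^T).
  by rewrite ricE // scale0r addr0.
rewrite (trace_eta_einstein phi2 eta_xi (compat a p ap) pos).
by rewrite addr0 mulNr -natrM addn1.
Qed.
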